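(* Let $X$ be a finite-dimensional Banach space with norm $|\cdot|$, and let $0<T\le\infty$. Suppose the set-valued map $F:[0,T)\times X\to\mathcal P(X)$ satisfies the following: (i) $F$ is $\mathcal L[0,T)\otimes\mathcal B(X)$ measurable; (ii) for each $R>0$ there exists $k_R\in L^1_{\mathrm{loc}}([0,T),\mathbb R)$ such that for any $\xi,\eta\in B(0,R)$, $$d_H(F(t,\xi),F(t,\eta))\le k_R(t)\,|\xi-\eta|\qquad\text{a.e. } t\in[0,T);$$ (iii) for each $R>0$ there exists $\alpha_R\in L^1_{\mathrm{loc}}([0,T),\mathbb R)$ such that for each $\xi\in B(0,R)$, $$\sup\{|\zeta| : \zeta\in F(t,\xi)\}\le\alpha_R(t)\qquad\text{a.e. } t\in[0,T).$$ Fix $\xi\in X$ and let $z:[0,T)\to X$ be a solution of $$\dot x\in \operatorname{clco}F(t,x),\qquad x(0)=\xi .$$ Let $r:[0,T)\to\mathbb R$ be a continuous function satisfying $r(t)>0$ for all $t\in[0,T)$. Then there exist $\eta^0\in B(\xi,r(0))$ and a solution $x:[0,T)\to X$ of $$\dot x\in F(t,x),\qquad x(0)=\eta^0,$$ which satisfies $$|z(t)-x(t)|\le r(t)\qquad\text{for all } t\in[0,T).$$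
   Context: $\mathcal P(X)$ is the family of all nonempty closed subsets of $X$. $\mathcal L[0,T)$ is the $\sigma$-field of Lebesgue measurable subsets of $[0,T)$ and $\mathcal B(X)$ is the family of Borel subsets of $X$; measurability of $F$ is meant in the usual sense for set-valued maps, i.e. $\{(t,\xi): F(t,\xi)\cap O\neq\emptyset\}\in\mathcal L[0,T)\otimes\mathcal B(X)$ for every open $O\subseteq X$. For $\xi\in X$ and $\rho\ge 0$, $B(\xi,\rho)=\{\eta\in X: |\eta-\xi|\le \rho\}$ is the closed ball. For $K\in\mathcal P(X)$, $d(\xi,K)=\inf\{|\xi-\eta|:\eta\in K\}$, and for $K,L\in\mathcal P(X)$ the Hausdorff distance is $d_H(K,L)=\max\{\sup_{\xi\in K}d(\xi,L),\ \sup_{\eta\in L}d(\eta,K)\}$. $\operatorname{clco}$ denotes the closed convex hull. $L^1_{\mathrm{loc}}([0,T),\mathbb R)$ is the space of locally integrable functions on $[0,T)$. For an interval $\mathcal I\subseteq[0,\infty)$, a function $x:\mathcal I\to X$ is a solution of a differential inclusion $\dot x(t)\in G(t,x(t))$ if it is absolutely continuous and satisfies the inclusion for almost every $t\in\mathcal I$.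
   Formalization: In (ii) the exceptional null set of t is taken independent of ξ, η (with a pair-dependent null set the claim fails, e.g. F(t,t)={0,2}, F(t,ξ)={0} otherwise, z(t)=t); absolute continuity on [0,T) means on each compact subinterval. *)

(* Defs.v *)
From HB Require Import structures.
From mathcomp Require Import all_boot all_order all_algebra.
From mathcomp Require Import all_classical all_reals all_analysis.
Set Implicit Arguments.
Unset Strict Implicit.
Unset Printing Implicit Defensive.
Import Order.TTheory GRing.Theory Num.Theory.
Import numFieldNormedType.Exports.
Local Open Scope classical_set_scope.
Local Open Scope ring_scope.

Definition finite_dimensional (R : realType) (X : normedModType R) : Prop :=
  exists (n : nat) (b : 'I_n -> X),
    forall v : X, exists c : 'I_n -> R, v = \sum_(i < n) c i *: b i.

(** The interval [0, T); the endpoint [T] may be [+oo]. *)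
Definition horizon (R : realType) (T : \bar R) : set R :=
  [set t | 0 <= t /\ (t%:E < T)%E].

(** The Lebesgue measurable sets are the Carathéodory measurable sets of the
    Lebesgue outer measure, which are strictly more than the Borel sets. *)
Definition lebesgue_subsets (R : realType) (D : set R) : set (set R) :=
  [set A | A `<=` D /\ ((@wlength R idfun)^*)%mu.-cara.-measurable A].

(** The product sigma-field of subsets of [D * X] generated by the rectangles
    [A * B] with [A] a Lebesgue measurable subset of [D] and [B] Borel in [X]. *)
Definition lebesgue_borel (R : realType) (X : normedModType R) (D : set R) :
    set (set (R * X)) :=
  <<s D `*` [set: X],
      [set A `*` B | A in lebesgue_subsets D & B in <<s (@open X) >>] >>.

Definition setvalued_measurable (R : realType) (X : normedModType R)
    (D : set R) (F : R -> X -> set X) : Prop :=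
  forall O : set X, open O ->
    lebesgue_borel D [set p : R * X | D p.1 /\ F p.1 p.2 `&` O !=set0].

(** Local integrability on a not necessarily open set, for Lebesgue measurable
    (rather than only Borel measurable) functions. *)
Definition L1_loc (R : realType) (D : set R) (k : R -> R) : Prop :=
  forall K : set R, compact K -> K `<=` D ->
    (@completed_lebesgue_measure R).-integrable K (EFin \o k).

Definition dist_set (R : realType) (X : normedModType R)
    (xi : X) (K : set X) : \bar R :=
  ereal_inf [set `|xi - eta|%:E | eta in K].

(** Extended-real valued, since the sets need not be bounded. *)
Definition hausdorff_dist (R : realType) (X : normedModType R)
    (K L : set X) : \bar R :=
  maxe (ereal_sup [set dist_set xi L | xi in K])
       (ereal_sup [set dist_set eta K | eta in L]).

Definition clco (R : realType) (X : normedModType R) (A : set X) : set X :=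
  smallest [set C | closed C /\ convex_set (C : set (convex_lmodType X))] A.

(** The exceptional null set does not depend on the two points. If it were
    allowed to, [F t t = {0, 2}] and [F t xi = {0}] for [xi <> t] would be
    admissible on the real line, although [t |-> t] solves the convexified
    inclusion and the solutions of the original one are all constant. *)
Definition locally_lipschitz_map (R : realType) (X : normedModType R)
    (D : set R) (F : R -> X -> set X) : Prop :=
  forall rho : R, 0 < rho ->
    exists k : R -> R, L1_loc D k /\
      {ae (@lebesgue_measure R), forall t, D t ->
        forall xi eta : X,
          closed_ball_ Num.norm 0 rho xi -> closed_ball_ Num.norm 0 rho eta ->
          (hausdorff_dist (F t xi) (F t eta) <= (k t * `|xi - eta|)%:E)%E}.

Definition locally_bounded_map (R : realType) (X : normedModType R)
    (D : set R) (F : R -> X -> set X) : Prop :=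
  forall rho : R, 0 < rho ->
    exists alpha : R -> R, L1_loc D alpha /\
      forall xi : X, closed_ball_ Num.norm 0 rho xi ->
        {ae (@lebesgue_measure R), forall t, D t ->
          (ereal_sup [set `|zeta|%:E | zeta in F t xi] <= (alpha t)%:E)%E}.

Definition abs_continuous_itv (R : realType) (X : normedModType R)
    (a b : R) (x : R -> X) : Prop :=
  forall e : R, 0 < e -> exists2 d : R, 0 < d &
    forall (n : nat) (u v : 'I_n -> R),
      (forall i, a <= u i <= v i /\ v i <= b) ->
      trivIset [set: 'I_n] (fun i => `]u i, v i[%classic) ->
      \sum_(i < n) (v i - u i) < d ->
      \sum_(i < n) `|x (v i) - x (u i)| < e.

(** On an interval that is not compact, absolute continuity is required on each
    compact subinterval: uniformly on [0, T) it would fail already for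
    [x' = 1 / (1 - t)] with [T = 1]. *)
Definition abs_continuous (R : realType) (X : normedModType R)
    (D : set R) (x : R -> X) : Prop :=
  forall a b : R, `[a, b]%classic `<=` D -> abs_continuous_itv a b x.

(** [x] is a function on the interval [D]; its values outside [D] matter at
    most at the endpoints of [D], through differentiability there, and these
    are negligible. *)
Definition is_solution (R : realType) (X : normedModType R)
    (D : set R) (G : R -> X -> set X) (x : R -> X) : Prop :=
  abs_continuous D x /\
  {ae (@lebesgue_measure R), forall t, D t ->
    derivable x t 1 /\ G t (x t) (derive1 x t)}.

(* Main.v *)
Require Import Defs.
From mathcomp Require Import all_boot all_order all_algebra.
From mathcomp Require Import all_classical all_reals all_analysis.
From mathcomp Require Import ring lra.
From mathcomp Require Import measurable_realfun.
Set Implicit Arguments.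
Unset Strict Implicit.
Unset Printing Implicit Defensive.
Import Order.TTheory GRing.Theory Num.Theory.
Import numFieldNormedType.Exports.
Local Open Scope classical_set_scope.
Local Open Scope ring_scope.

(* The arc x is built by successive approximation: g_{m+1} is chosen nearly in
   F(t, x_m(t)) and nearly closest to g_m, and x_{m+1} has velocity g_{m+1}.
   To make this converge on all of [0, T) at once, corrections are integrated
   backwards from T, x_{m+1}(t) = x_m(t) - \int_t^T (g_{m+1} - g_m), and measured
   against a positive nonincreasing weight p <= r with
   \int_t^T k p <= q p(t), q small, where k is a local Lipschitz rate (p is
   essentially min(1, min_{[0,t]} r) exp(- \int_0^t k / q)). An increment
   |g_{m+1} - g_m| <= a k p then moves the arc by at most a q p, so the errors
   decrease geometrically; this is why the initial value is not kept equal to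
   that of z.
   The starting arc chatters: z' is approximated within k p / 2 by a countably
   valued function whose values are averages of points close to F(t, z(t)), and
   each of its level sets, cut into pieces on which \int k / p is small, is
   divided into parts of equal measure on which the points being averaged are
   used in turn, so that the integral over the whole piece is unchanged.
   Measurable selections take values in a dense sequence, the least admissible
   index being chosen. Integrals of vector functions are taken coordinatewise in
   a basis with bounded coordinates. *)

(** * Coordinates *)

(** Since [r] may tend to 0 at [T], an estimate of Gronwall type issued from time 0, whose errors
    only grow, cannot be kept below it. Errors at time t are therefore bounded by what happens after
    t, and a nonincreasing weight makes such tails small relative to its value at t. Two
    normalisations support this. The rate [k] is at least 1, so its primitive is strictly
    increasing; and it is a Lipschitz rate for points within distance 1 of z(t), whence the cap p <=
    1. The constant is q = 1 / (6 K), with K the factor lost by integrating coordinatewise: velocity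
    increments 3 * 2^-(m+1) k p then move the arc by 2^-(m+2) p, and together with an initial error
    p / 2 these displacements add up to at most p. The data are Lebesgue measurable while integrals
    are taken for Borel functions, so the rates are replaced by Borel majorants, and every selection
    is Borel with its defining conditions holding almost everywhere. *)

Definition bounded_coordinates (R : realType) (X : normedModType R) (n : nat)
    (b : 'I_n -> X) (c : 'I_n -> X -> R) (C : R) : Prop :=
  [/\ 0 < C, forall x, x = \sum_(i < n) c i x *: b i,
      forall i a x y, c i (a *: x + y) = a * c i x + c i y &
      forall i x, `|c i x| <= C * `|x|].

(** A spanning family of least length is free: a vector with nonzero coefficient in a linear
    relation could be dropped from it. *)
Lemma finite_dimensional_basis (R : realType) (X : normedModType R) :
  finite_dimensional X ->
  exists (n : nat) (b : 'I_n -> X),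
    (forall v : X, exists c : 'I_n -> R, v = \sum_(i < n) c i *: b i) /\
    (forall c : 'I_n -> R, \sum_(i < n) c i *: b i = 0 -> forall i, c i = 0).
Proof.
move=> hX.
pose P n := `[< exists b : 'I_n -> X,
  forall v : X, exists c : 'I_n -> R, v = \sum_(i < n) c i *: b i >].
have exP : exists n, P n by have [n [b hb]] := hX; exists n; apply/asboolP; exists b.
case: (ex_minnP exP) => n /asboolP[b hb] nmin.
exists n, b; split=> // c c0 i; apply: contrapT => ci0.
case: n b hb nmin c c0 i ci0 => [|m] b hb nmin c c0 i ci0; first by case: i ci0.
suff /nmin : P m by rewrite ltnn.
apply/asboolP; exists (fun j => b (lift i j)) => v.
have [d ->] := hb v.
exists (fun j => d (lift i j) - d i / c i * c (lift i j)).
have cb : b i = - \sum_(j < m) (c (lift i j) / c i) *: b (lift i j).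
  move: c0; rewrite (bigD1_ord i)//= => /eqP; rewrite addr_eq0 => /eqP c0.
  apply: (scalerI (a := c i)); first exact/eqP.
  rewrite c0 scalerN scaler_sumr; congr (- _); apply: eq_bigr => j _.
  by rewrite scalerA mulrCA mulfV ?mulr1//; apply/eqP.
rewrite (bigD1_ord i)//= {1}cb scalerN scaler_sumr addrC -sumrB.
apply: eq_bigr => j _; rewrite scalerA scalerBl; congr (_ - _ *: _).
by rewrite mulrA mulrAC.
Qed.

(** On the unit sphere of the sup norm of coefficients, which is compact, the continuous function a
    |-> |sum a_i b_i| has a positive minimum by freeness. [C] is its inverse, and homogeneity does
    the rest. *)
Lemma finite_dimensional_coordinates (R : realType) (X : normedModType R) :
  finite_dimensional X ->
  exists (n : nat) (b : 'I_n -> X) (c : 'I_n -> X -> R) (C : R),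
    bounded_coordinates b c C.
Proof.
move=> /finite_dimensional_basis[n [b [hb free]]].
pose c i x := projT1 (cid (hb x)) i.
have cE x : x = \sum_(i < n) c i x *: b i by rewrite /c; case: cid.
have cl i a x y : c i (a *: x + y) = a * c i x + c i y.
  apply/eqP; rewrite -subr_eq0; apply/eqP.
  apply: (free (fun i => c i (a *: x + y) - (a * c i x + c i y))).
  under eq_bigr do rewrite scalerBl scalerDl -scalerA.
  by rewrite sumrB big_split/= -scaler_sumr -!cE subrr.
exists n, b, c.
(* Without basis vectors the sphere is empty, and any positive constant serves. *)
case: n b hb free c cE cl => [|n] b hb free c cE cl.
  by exists 1; split=> // -[].
pose f (a : 'rV[R]_n.+1) := \sum_(i < n.+1) a 0 i *: b i.
pose S := [set a : 'rV[R]_n.+1 | `|a| = 1].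
have S0 : S !=set0.
  exists (const_mx 1); rewrite /S/=.
  apply/eqP; rewrite eq_le; apply/andP; split.
    rewrite [leLHS]mx_normrE; apply/bigmax_leP; split=> // i _.
    by rewrite mxE normr1.
  rewrite [leRHS]mx_normrE; apply: le_trans (le_bigmax _ _ (0, 0)) => /=.
  by rewrite mxE normr1.
have fc : continuous f.
  move=> a; apply: cvg_big => [||i _]; [exact: add_continuous|exact: nbhs_filter|].
  by apply: cvgZr_tmp; [exact: nbhs_filter|exact: coord_continuous].
have cS : compact S.
  apply: bounded_closed_compact.
    exists 1; split=> // M M1 a /= ->; exact: ltW.
  rewrite (_ : S = (fun a : 'rV[R]_n.+1 => `|a|) @^-1` [set 1])//.
  apply: closed_comp => [a _|]; first exact: norm_continuous.
  exact: closed_eq.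
have [|a0 aS amin] := compact_EVT_min (f := fun a => `|f a|) S0 cS.
  apply: continuous_subspaceT => a.
  by apply: continuous_comp; [exact: fc|exact: norm_continuous].
have fa0 : 0 < `|f a0|.
  rewrite normr_gt0; apply/eqP => /free a00.
  move: aS; rewrite inE /S/= (_ : a0 = 0) ?normr0; last by apply/rowP => i; rewrite a00 mxE.
  by move/eqP; rewrite eq_sym oner_eq0.
exists (`|f a0|^-1); split => // [|i x]; first by rewrite invr_gt0.
pose a : 'rV[R]_n.+1 := \row_i c i x.
have fax : f a = x by rewrite [RHS]cE; apply: eq_bigr => j _; rewrite mxE.
have ca : `|c i x| <= `|a|.
  rewrite [leRHS]mx_normrE; apply: le_trans (le_bigmax _ _ (0, i)) => /=.
  by rewrite mxE.
apply: (le_trans ca); rewrite mulrC ler_pdivlMr//.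
have [a00|an0] := eqVneq a 0; first by rewrite a00 normr0 mul0r.
have an : 0 < `|a| by rewrite normr_gt0.
have /amin : `|a|^-1 *: a \in S.
  by rewrite inE/S/= normrZ gtr0_norm ?invr_gt0// mulVf// gt_eqF.
have -> : f (`|a|^-1 *: a) = `|a|^-1 *: f a.
  by rewrite /f scaler_sumr; apply: eq_bigr => j _; rewrite mxE scalerA.
by rewrite normrZ gtr0_norm ?invr_gt0// fax mulrC ler_pdivlMr// mulrC.
Qed.

(** * Lebesgue measurable sets *)

Global Instance ae_lebesgue_filter (R : realType) :
  Filter (nbhs (almost_everywhere (@lebesgue_measure R))) :=
  ae_filter_ringOfSetsType (@lebesgue_measure R).

Section lebesgue_sets.
Context {R : realType}.
Notation mu := (@lebesgue_measure R).
Notation lebesgue_set := (((@wlength R idfun)^*)%mu.-cara.-measurable).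

Lemma measurable_lebesgue_set (A : set R) : measurable A -> lebesgue_set A.
Proof. exact: sub_caratheodory. Qed.

Lemma lebesgue_set_inner (A : set R) : lebesgue_set A ->
  exists B : set R, [/\ measurable B, B `<=` A & mu.-negligible (A `\` B)].
Proof.
rewrite -completed_caratheodory_measurable g_sigma_completed_algebra_genE.
move=> [/= B mB] [N nN] <-; exists B; split=> //.
by apply: negligibleS nN => x [[]].
Qed.

(** Each [C i] is replaced by a Borel subset differing from it by a null set, so the least
    admissible index is a Borel function; the condition then holds off a null set. *)
Lemma countable_selection (D : set R) (C : nat -> set R) :
  (forall i, lebesgue_set (C i)) ->
  {ae mu, forall t, D t -> exists i, C i t} ->
  exists iota : R -> nat, (forall i, measurable (iota @^-1` [set i])) /\
    {ae mu, forall t, D t -> C (iota t) t}.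
Proof.
move=> mC exC.
have /choice[B hB] := fun i => lebesgue_set_inner (mC i).
have mB i : measurable (B i) by have [] := hB i.
pose P t := fun i => `[< B i t >].
(* The default index 0 is taken where no [B i] contains t, so the fibre over 0 also contains the
   complement of their union. *)
pose iota t := if pselect (exists i, P t i) is left h then ex_minn h else 0%N.
have iotaP t i : B i t -> B (iota t) t /\ (iota t <= i)%N.
  move=> Bit; rewrite /iota; case: pselect => [h|]; last first.
    by case; exists i; exact/asboolP.
  by case: ex_minnP => m /asboolP ? hm; split=> //; apply: hm; exact/asboolP.
exists iota; split=> [i|].
  have -> : iota @^-1` [set i] =
      (B i `\` \bigcup_(j in `I_i) B j) `|`
      (if i == 0 then ~` \bigcup_j B j else set0)%N.
    apply/seteqP; split=> t /=.
      move=> <-; have [[j Bjt]|h] := pselect (exists j, B j t).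
        left; split; first by have [] := iotaP _ _ Bjt.
        by move=> [l /= li Bl]; have [_] := iotaP _ _ Bl; rewrite leqNgt li.
      right; rewrite /iota; case: pselect => [p|_]/=.
        by exfalso; have [j /asboolP Bjt] := p; apply: h; exists j.
      by move=> [j _ Bj]; apply: h; exists j.
    move=> [[Bit nB]|].
      have [Bt] := iotaP _ _ Bit; rewrite leq_eqVlt => /predU1P[//|lti].
      by case: nB; exists (iota t).
    case: eqP => // -> h; rewrite /iota; case: pselect => [p|//].
    by exfalso; have [j /asboolP Bjt] := p; apply: h; exists j.
  apply: measurableU.
    by apply: measurableD => //; apply: bigcup_measurable.
  by case: ifP => // _; apply: measurableC; exact: bigcupT_measurable.
have nB : mu.-negligible (\bigcup_i (C i `\` B i)).
  by apply: negligible_bigcup => i; have [] := hB i.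
have : {ae mu, forall t, ~ (\bigcup_i (C i `\` B i)) t}.
  by apply: negligibleS nB => t /=; rewrite not_notP.
apply: filterS2 exC => t exC nt Dt.
have [i Cit] := exC Dt.
have Bit : B i t.
  by apply: contrapT => nBit; apply: nt; exists i.
by have [Bt _] := iotaP _ _ Bit; have [_ sub _] := hB (iota t); exact: sub.
Qed.

(** The sets [S] whose pull-back along the graph of [x] is Lebesgue measurable form a sigma-field of
    subsets of D x X; for rectangles the same argument is repeated in the Borel factor. This is how
    joint measurability of F yields measurability of t |-> F(t, x(t)). *)
Lemma lebesgue_borel_graph (X : normedModType R) (D : set R) (x : R -> X)
    (S : set (R * X)) :
  lebesgue_set D ->
  (forall O : set X, open O -> lebesgue_set (D `&` x @^-1` O)) ->
  lebesgue_borel D S -> lebesgue_set [set t | D t /\ S (t, x t)].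
Proof.
move=> mD mx.
apply: (smallest_sub (X := [set S : set (R * X) |
  lebesgue_set [set t | D t /\ S (t, x t)]])).
  split=> /=.
  - rewrite (_ : [set t | _] = set0); first exact: measurable0.
    by apply/seteqP; split=> t // -[].
  - move=> A mA.
    rewrite (_ : [set t | _] = D `\` [set t | D t /\ A (t, x t)]).
      exact: measurableD.
    apply/seteqP; split=> t /=; first by move=> [Dt [_ nA]]; split=> // -[].
    by move=> [Dt nA]; split=> //; split=> // At; apply: nA.
  - move=> A mA.
    rewrite (_ : [set t | _] = \bigcup_i [set t | D t /\ A i (t, x t)]).
      by apply: bigcupT_measurable => i; exact: mA.
    apply/seteqP; split=> t /=; first by move=> [Dt [i _ Ai]]; exists i.
    by move=> [i _ [Dt Ai]]; split=> //; exists i.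
move=> _ [A [AD mA]] [B mB] <- /=.
suff mxB : lebesgue_set (D `&` x @^-1` B).
  rewrite (_ : [set t | _] = A `&` (D `&` x @^-1` B)); first exact: measurableI.
  apply/seteqP; split=> t /=; first by move=> [Dt [At Bt]].
  by move=> [At [Dt Bt]].
move: B mB; apply: (smallest_sub (X := [set B : set X |
  lebesgue_set (D `&` x @^-1` B)])) => //.
split=> /=.
- by rewrite preimage_set0 setI0; exact: measurable0.
- move=> B mB; rewrite (_ : _ `&` _ = D `\` (D `&` x @^-1` B)).
    exact: measurableD.
  apply/seteqP; split=> t /=; first by move=> [Dt [_ nB]]; split=> // -[].
  by move=> [Dt nB]; split=> //; split=> // Bt; apply: nB.
- move=> B mB; rewrite preimage_bigcup setI_bigcupr.
  by apply: bigcupT_measurable => i; exact: mB.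
Qed.

End lebesgue_sets.

(** * Absolutely continuous functions and primitives *)

Section horizon.
Context {R : realType} (T : \bar R).
Local Notation D := (horizon T).

Lemma horizon_le (s t : R) : 0 <= s -> s <= t -> D t -> D s.
Proof.
by move=> s0 st [_ tT]; split=> //; apply: le_lt_trans tT; rewrite lee_fin.
Qed.

Lemma measurable_horizon : measurable D.
Proof.
apply: is_interval_measurable => s t [s0 sT] [t0 tT] u /andP[su ut].
by apply: (@horizon_le _ t) => //; exact: le_trans su.
Qed.

Lemma horizon_itvcc (s : R) : D s -> `[0, s]%classic `<=` D.
Proof. by move=> Ds t /=; rewrite in_itv/= => /andP[t0 ts]; exact: horizon_le Ds. Qed.

Lemma horizon_exhaustion : (0 < T)%E -> exists s : nat -> R,
  [/\ forall n, D (s n), {homo s : m n / (m <= n)%N >-> m <= n} &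
      forall t, D t -> exists n, t < s n].
Proof.
move=> T0; case: T T0 => [r||//]; rewrite ?lte_fin => r0.
- exists (fun n => r * (1 - n.+1%:R^-1)); split=> [n|m n mn|t [t0]].
  + have n1 : n.+1%:R^-1 <= 1 :> R by rewrite invf_le1// ler1n.
    split; first by rewrite mulr_ge0 ?subr_ge0// ltW.
    by rewrite lte_fin gtr_pMr// gtrBl invr_gt0.
  + apply: ler_wpM2l; first exact: ltW.
    by rewrite lerD2l lerN2 lef_pV2 ?posrE// ler_nat.
  + rewrite lte_fin => tr.
    have [n nP] : exists n, (r / (r - t)) < n.+1%:R.
      exists (Num.truncn (r / (r - t))); apply: Num.Theory.truncnS_gt.
    exists n; rewrite mulrBr mulr1 ltrBrDr -ltrBrDl ltr_pdivrMr//.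
    by rewrite -ltr_pdivrMl ?subr_gt0// mulrC.
- exists (fun n => n%:R); split=> [n|m n mn|t [t0 _]].
  + by split; [exact: ler0n|exact: ltry].
  + by rewrite ler_nat.
  + by exists (Num.truncn t).+1; exact: Num.Theory.truncnS_gt.
Qed.

End horizon.

(** Velocities are handled below as limits of difference quotients, which can be added and read in
    coordinates; this converts to and from the derivative of [is_solution]. *)
Lemma derive1P (R : realType) (X : normedModType R) (x : R -> X) (t : R) (g : X) :
  (h^-1 *: (x (h + t) - x t) @[h --> 0^'] --> g) <->
  derivable x t 1 /\ derive1 x t = g.
Proof.
have E : (fun h => h^-1 *: ((x \o shift t) (h *: 1) - x t)) =
         (fun h => h^-1 *: (x (h + t) - x t)).
  by apply/funext => h /=; rewrite [h%:A]mulr1.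
split=> [xg|[dx <-]].
  split; first by rewrite /derivable E; apply/cvg_ex; exists g.
  exact: cvg_lim xg.
by move: dx; rewrite /derivable E /derive1.
Qed.

Section abs_continuous.
Context {R : realType}.
Implicit Types X : normedModType R.

Lemma abs_continuousD X (D : set R) (x y : R -> X) :
  abs_continuous D x -> abs_continuous D y ->
  abs_continuous D (fun t => x t + y t).
Proof.
move=> cx cy a b ab e e0.
have e2 : 0 < e / 2 by rewrite divr_gt0.
have [d1 d10 h1] := cx a b ab _ e2; have [d2 d20 h2] := cy a b ab _ e2.
exists (Num.min d1 d2) => [|n u v uv tuv]; first by rewrite lt_min d10.
rewrite lt_min => /andP[ud1 ud2]; rewrite (splitr e).
apply: le_lt_trans (ltrD (h1 n u v uv tuv ud1) (h2 n u v uv tuv ud2)).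
rewrite -big_split/=; apply: ler_sum => i _.
by rewrite opprD addrACA ler_normD.
Qed.

Lemma abs_continuous_cst X (D : set R) (v : X) : abs_continuous D (cst v).
Proof.
move=> a b ab e e0; exists 1 => // n u w _ _ _.
by rewrite big1// => i _; rewrite subrr normr0.
Qed.

Lemma abs_continuousZ X (D : set R) (f : R -> R) (v : X) :
  abs_continuous D (f : R -> R^o) -> abs_continuous D (fun t => f t *: v).
Proof.
move=> cf a b ab e e0.
have v0 : 0 < `|v| + 1 by rewrite ltr_wpDl.
have [d d0 h] := cf a b ab _ (divr_gt0 e0 v0).
exists d => // n u w uw tuw ud.
have := h n u w uw tuw ud; rewrite ltr_pdivlMr//; apply: le_lt_trans.
rewrite mulr_suml; apply: ler_sum => i _.
by rewrite -scalerBl normrZ ler_wpM2l// lerDl.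
Qed.

Lemma abs_continuous_sum X (D : set R) n (x : 'I_n -> R -> X) :
  (forall i, abs_continuous D (x i)) ->
  abs_continuous D (fun t => \sum_i x i t).
Proof.
move=> cx; elim: n x cx => [|n IH] x cx.
  rewrite (_ : (fun _ => _) = cst 0); first exact: abs_continuous_cst.
  by apply/funext => t; rewrite big_ord0.
rewrite (_ : (fun _ => _) = fun t => x ord0 t + \sum_i x (lift ord0 i) t).
  by apply: abs_continuousD => //; apply: IH.
by apply/funext => t; rewrite big_ord_recl.
Qed.

Lemma abs_continuous_itv_continuous X (a b : R) (x : R -> X) :
  abs_continuous_itv a b x -> {within `[a, b], continuous x}.
Proof.
move=> cx; apply/subspace_continuousP => t; rewrite /= in_itv/= => /andP[at_ tb].
apply/cvgrPdist_lt => e e0; have [d d0 h] := cx e e0.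
rewrite near_withinE; near=> s => /=; rewrite in_itv/= => /andP[as_ sb].
have std : `|t - s| < d.
  by near: s; exact: cvgr_dist_lt.
pose u (i : 'I_1) := Num.min s t; pose w (i : 'I_1) := Num.max s t.
have := h 1%N u w; rewrite !big_ord1 /u /w; have [st|ts] := leP s t.
- apply=> //.
  + by rewrite as_ tb.
  + by move=> i j _ _ _; rewrite !ord1.
  + by move: std; rewrite ger0_norm ?subr_ge0.
- rewrite distrC; apply => //.
  + by rewrite at_ sb (ltW ts).
  + by move=> i j _ _ _; rewrite !ord1.
  + by move: std; rewrite distrC gtr0_norm ?subr_gt0.
Unshelve. all: by end_near. Qed.

End abs_continuous.

Section primitive.
Context {R : realType} (T : \bar R).
Notation mu := (@lebesgue_measure R).
Local Notation D := (horizon T).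
Implicit Types f : R -> R.

Lemma Rintegral_itv_increment f (u v : R) : 0 <= u -> u <= v ->
  mu.-integrable `[0, v] (EFin \o f) ->
  \int[mu]_(t in `[0, v]) f t - \int[mu]_(t in `[0, u]) f t =
  \int[mu]_(t in `]u, v]) f t.
Proof.
move=> u0 uv fi.
by rewrite Rintegral_itvB//= bnd_simp.
Qed.

(** Extended by 0 outside [0, b], [f] is integrable on the line, so the integral of |f| over a set
    is small when the measure of the set is; this is applied to the union of the intervals []u i, v
    i[]. *)
Lemma primitive_abs_continuous f :
  (forall s, D s -> mu.-integrable `[0, s] (EFin \o f)) ->
  abs_continuous D ((fun t => \int[mu]_(s in `[0, t]) f s) : R -> R^o).
Proof.
move=> fi a b abD e e0.
have [ba|ab] := ltP b a.
  exists 1 => // -[|n] u v uv _ _; first by rewrite big_ord0.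
  have [/andP[au uv0] vb] := uv ord0.
  by have := le_trans au (le_trans uv0 vb); rewrite leNgt ba.
have Db : D b by apply: abD; rewrite /= in_itv/= ab lexx.
have Da : D a by apply: abD; rewrite /= in_itv/= ab lexx.
have fb := fi _ Db.
pose g := f \_ `[0, b].
have gi : mu.-integrable setT (EFin \o g).
  by rewrite /g -restrict_EFin; apply/integrable_restrict => //=; rewrite setTI.
have [d [d0 hd]] := integral_normr_continuous gi e0.
exists d => // n u v uv tuv uvd.
pose I i : set R := `]u i, v i[%classic.
pose A := \big[setU/set0]_(i < n) I i.
have mI i : measurable (I i) by exact: measurable_itv.
have mA : measurable A by exact: bigsetU_measurable.
have muA : (mu A < d%:E)%E.
  rewrite /A measure_bigsetU_ord// (eq_bigr (fun i => (v i - u i)%:E)).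
    by rewrite sumEFin lte_fin.
  move=> i _; transitivity (lebesgue_measure (I i)) => //.
  rewrite /I lebesgue_measure_itv/= lte_fin.
  case: ltP => // vu; have [/andP[_ uv0] _] := uv i.
  by rewrite (_ : v i = u i) ?subrr//; apply/eqP; rewrite eq_le vu.
have gA : mu.-integrable A (EFin \o (fun t => `|g t|)).
  apply: (@integrableS _ _ _ _ setT) => //.
  rewrite (_ : _ \o _ = abse \o (EFin \o g)); last exact/funext.
  exact: integrable_abse.
apply: le_lt_trans (hd A mA muA).
rewrite -lee_fin /Rintegral fineK; last exact: integrable_fin_num.
rewrite ge0_integral_bigsetU//=; first last.
- by move/integrableP : gA => [].
- by apply: sub_trivIset tuv.
- exact: index_enum_uniq.
rewrite -sumEFin; apply: lee_sum => i _.
have [/andP[au uv0] vb] := uv i.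
have u0 : 0 <= u i by apply: le_trans au; case: Da.
have fv : mu.-integrable `[0, v i] (EFin \o f).
  by apply: integrableS fb => //; apply: subset_itvl; rewrite bnd_simp.
rewrite Rintegral_itv_increment//.
have subI : `]u i, v i[ `<=` `[0, b].
  by apply: subset_itv; rewrite bnd_simp.
have gE : \int[mu]_(t in `]u i, v i]) f t = \int[mu]_(t in `]u i, v i[) g t.
  rewrite -Rintegral_itv_bndo_bndc; last first.
    by apply: integrableS fb => //; apply: subset_itv; rewrite bnd_simp.
  apply: eq_Rintegral => t; rewrite inE => tI.
  by rewrite /g patchE mem_set//; exact: subI.
rewrite gE.
have gI : mu.-integrable `]u i, v i[ (EFin \o g).
  exact: (@integrableS _ _ _ _ setT).
apply: le_trans (_ : (\int[mu]_(t in `]u i, v i[) `|g t|)%:E <= _)%E.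
  by rewrite lee_fin; exact: le_normr_Rintegral.
rewrite /Rintegral fineK//; apply: integrable_fin_num => //.
rewrite (_ : (fun _ => _) = abse \o (EFin \o g)); last exact/funext.
exact: integrable_abse.
Qed.

(** Lebesgue differentiation is applied to the countably many truncations of [f] to [[0, s n]]; near
    a time t < s n they have the same primitive as [f]. The point 0 is put in the null set, because
    the quotient there also involves negative times. *)
Lemma primitive_ae_derivative f : (0 < T)%E ->
  (forall s, D s -> mu.-integrable `[0, s] (EFin \o f)) ->
  {ae mu, forall t, D t ->
    h^-1 *: ((\int[mu]_(s in `[0, h + t]) f s) - (\int[mu]_(s in `[0, t]) f s) : R^o)
      @[h --> 0^'] --> (f t : R^o)}.
Proof.
move=> T0 fi.
have [s [sD _ sT]] := horizon_exhaustion T0.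
pose g n := f \_ `[0, s n].
have lg n : {ae mu, forall x, lebesgue_pt (g n) x}.
  apply: lebesgue_differentiation; apply: integrable_locally => //.
  exact: fi.
have : {ae mu, forall t, t <> 0}.
  exists [set 0]; split=> //; first exact: lebesgue_measure_set1.
  by move=> t /= /notP.
move/ae_foralln: lg.
apply: filterS2 => t lgt t0 Dt.
have [n tn] := sT _ Dt.
have t_gt0 : 0 < t by rewrite lt_neqAle eq_sym; case: Dt => -> _; rewrite andbT; exact/eqP.
have gi : mu.-integrable `[0, s n] (EFin \o g n).
  by rewrite /g -restrict_EFin; apply/integrable_restrict => //=; rewrite setIid; exact: fi.
have /= := @FTC1_lebesgue_pt R (g n) (BLeft 0) t (s n) tn gi.
move=> /(_ t_gt0 (lgt n)) /derive1P.
rewrite /g patchE mem_set/=; last by rewrite /= in_itv/= ltW//= ltW.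
apply: cvg_trans; apply: near_eq_cvg.
near=> h; congr (_ *: (_ - _)).
  apply: eq_Rintegral => r; rewrite inE/= in_itv/= => /andP[r0 rh].
  rewrite patchE mem_set//= in_itv/= r0/= (le_trans rh)//.
  rewrite -lerBrDr; apply: le_trans (ler_norm _) _; rewrite ltW//.
  by near: h; apply: dnbhs0_lt; rewrite subr_gt0.
apply: eq_Rintegral => r; rewrite inE/= in_itv/= => /andP[r0 rh].
by rewrite patchE mem_set//= in_itv/= r0/= (le_trans rh)// ltW.
Unshelve. all: by end_near. Qed.

End primitive.

(** * Coordinatewise measurability and integration of vector functions *)

Definition vmeasurable (R : realType) (X : normedModType R) (n : nat)
    (c : 'I_n -> X -> R) (A : set R) (u : R -> X) : Prop :=
  forall i, measurable_fun A (c i \o u).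

Definition vintegrable (R : realType) (X : normedModType R) (n : nat)
    (c : 'I_n -> X -> R) (A : set R) (u : R -> X) : Prop :=
  forall i, (@lebesgue_measure R).-integrable A (EFin \o (c i \o u)).

Definition vintegral (R : realType) (X : normedModType R) (n : nat)
    (b : 'I_n -> X) (c : 'I_n -> X -> R) (A : set R) (u : R -> X) : X :=
  \sum_(i < n) (\int[@lebesgue_measure R]_(t in A) c i (u t)) *: b i.

Section vector_integral.
Context {R : realType} {X : normedModType R} {n : nat}.
Context (b : 'I_n -> X) (c : 'I_n -> X -> R) (C : R).
Hypothesis bc : bounded_coordinates b c C.
Notation mu := (@lebesgue_measure R).
Implicit Types (A : set R) (u w : R -> X) (phi : R -> R).

(** The factor lost when the norm of a coordinatewise integral is bounded by the integral of a bound
    on the norm. The summand 1 keeps it positive in dimension zero. *)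
Definition coord_norm : R := C * (\sum_(i < n) `|b i|) + 1.

Lemma coord_norm_gt0 : 0 < coord_norm.
Proof.
have [C0 _ _ _] := bc.
by rewrite ltr_wpDl// mulr_ge0 ?(ltW C0)// sumr_ge0.
Qed.

Lemma coordD i x y : c i (x + y) = c i x + c i y.
Proof. by have [_ _ cl _] := bc; have := cl i 1 x y; rewrite scale1r mul1r. Qed.

Lemma coord0 i : c i 0 = 0.
Proof. by have := coordD i 0 0; rewrite addr0 => /eqP; rewrite addrC -subr_eq subrr => /eqP. Qed.

Lemma coordZ i a x : c i (a *: x) = a * c i x.
Proof. by have [_ _ cl _] := bc; have := cl i a x 0; rewrite addr0 coord0 addr0. Qed.

Lemma coordN i x : c i (- x) = - c i x.
Proof. by rewrite -scaleN1r coordZ mulN1r. Qed.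

Lemma coordB i x y : c i (x - y) = c i x - c i y.
Proof. by rewrite coordD coordN. Qed.

Lemma coord_sum i (I : Type) (s : seq I) (F : I -> X) :
  c i (\sum_(j <- s) F j) = \sum_(j <- s) c i (F j).
Proof.
elim: s => [|j s IH]; first by rewrite !big_nil coord0.
by rewrite !big_cons coordD IH.
Qed.

Lemma coord_continuous_fun i : continuous (c i : X -> R^o).
Proof.
have [C0 _ _ cb] := bc.
move=> x; apply/cvgrPdist_lt => e e0; near=> y.
rewrite -coordB; apply: (le_lt_trans (cb _ _)).
rewrite mulrC -ltr_pdivlMr//.
by near: y; apply: cvgr_dist_lt => //; rewrite divr_gt0.
Unshelve. all: by end_near. Qed.

Lemma le_norm_coord (a : R) x : (forall i, `|c i x| <= a) ->
  `|x| <= (\sum_(i < n) `|b i|) * a.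
Proof.
have [_ cE _ _] := bc => ca; rewrite [in leLHS](cE x).
apply: (le_trans (ler_norm_sum _ _ _)); rewrite mulr_suml.
by apply: ler_sum => i _; rewrite normrZ mulrC ler_wpM2l.
Qed.

Lemma rat_approximation (x e : R) : 0 < e -> exists q : rat, `|x - ratr q| < e.
Proof.
move=> e0; have [|q] := @rat_in_itvoo R (x - e) (x + e).
  by rewrite ltrD2l gtrN.
by rewrite in_itv/= => qx; exists q; rewrite distrC ltr_distl.
Qed.

(** Rational combinations of the basis, enumerated by [pickle]; an index that encodes nothing stands
    for 0. *)
Lemma dense_sequence : exists d : nat -> X,
  forall x (e : R), 0 < e -> exists j, `|x - d j| < e.
Proof.
have [C0 cE _ _] := bc.
pose d j := if @unpickle {ffun 'I_n -> rat} j is Some q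
  then \sum_(i < n) ratr (q i) *: b i else 0.
exists d => x e e0.
pose M := (\sum_(i < n) `|b i|) + 1.
have M0 : 0 < M by rewrite ltr_wpDl// sumr_ge0.
have /choice[q hq] := fun i => rat_approximation (c i x) (divr_gt0 e0 M0).
exists (pickle [ffun i => q i]); rewrite /d pickleK [in X in X - _](cE x) -sumrB.
apply: (le_lt_trans (ler_norm_sum _ _ _)).
apply: (@le_lt_trans _ _ (\sum_(i < n) e / M * `|b i|)).
  by apply: ler_sum => i _; rewrite ffunE -scalerBl normrZ ler_wpM2r// ltW.
rewrite -mulr_sumr mulrAC ltr_pdivrMr// ltr_pM2l//.
by rewrite ltrDl.
Qed.

(** An open set is the union of the countably many boxes contained in it that have rational centre
    and radius 1 / (m + 1) in coordinates, and [u] pulls boxes back to measurable sets. *)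
Lemma vmeasurable_open A u (O : set X) : measurable A -> vmeasurable c A u ->
  open O -> measurable (A `&` u @^-1` O).
Proof.
move=> mA mu_ oO.
have [C0 cE _ _] := bc.
pose box (p : {ffun 'I_n -> rat} * nat) : set X :=
  [set x | forall i, `|c i x - ratr (p.1 i)| < p.2.+1%:R^-1].
have mbox p : measurable (A `&` u @^-1` (box p)).
  rewrite (_ : _ `&` _ = \big[setI/A]_(i < n)
    (A `&` (c i \o u) @^-1` ball (ratr (p.1 i) : R) p.2.+1%:R^-1)).
    elim/big_ind : _ => // [B B' mB mB'|i _]; first exact: measurableI.
    by apply: mu_ => //; exact: measurable_ball.
  apply/seteqP; split=> t.
    move=> [At pt]; elim/big_ind : _ => // i _; split=> //=.
    by rewrite /ball/= distrC; exact: pt.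
  move=> h; split=> [|i].
    elim/big_rec : _ h => // i B _ IH [_]; exact: IH.
  have : (A `&` (c i \o u) @^-1` ball (ratr (p.1 i) : R) p.2.+1%:R^-1) t.
    by move: h; rewrite (bigD1 i)//= => -[].
  by rewrite /ball/= distrC => -[].
have -> : A `&` u @^-1` O = \bigcup_j
    (if unpickle j is Some p then if `[< box p `<=` O >]
     then A `&` u @^-1` (box p) else set0 else set0).
  apply/seteqP; split=> t.
    move=> [At Out]; have /nbhs_ballP[e /= e0 eO] : nbhs (u t) O.
      by apply: open_nbhs_nbhs.
    pose M := (\sum_(i < n) `|b i|) + 1.
    have M0 : 0 < M by rewrite ltr_wpDl// sumr_ge0.
    (* This [m] makes two box radii less than e / M, so a box containing [u t] lies in the ball of
       radius e around it. *)
    pose m := Num.truncn (M * 2 / e).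
    have mM : m.+1%:R^-1 * 2 < e / M.
      rewrite ltr_pdivlMr// -mulrA mulrC ltr_pdivrMr// [e * _]mulrC -ltr_pdivrMr//.
      by rewrite (mulrC 2) Num.Theory.truncnS_gt.
    have m0 : 0 < m.+1%:R^-1 :> R by [].
    have /choice[q hq] := fun i => rat_approximation (c i (u t)) m0.
    exists (pickle ([ffun i => q i], m)) => //; rewrite pickleK; case: asboolP => [_|].
      by split=> // i; rewrite ffunE; exact: hq.
    case=> y yq; apply: eO; rewrite -ball_normE/=.
    have : `|u t - y| <= (\sum_(i < n) `|b i|) * (e / M).
      apply: le_norm_coord => i; apply/ltW; apply: le_lt_trans mM.
      rewrite coordB mulr_natr mulr2n.
      apply: (le_trans (ler_distD (ratr (q i)) _ _)).
      rewrite lerD ?(ltW (hq i))// distrC.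
      by have := yq i; rewrite /= ffunE => /ltW.
    move=> /le_lt_trans; apply.
    by rewrite mulrCA gtr_pMr// ltr_pdivrMr// mul1r ltrDl.
  move=> [j _]; case: unpickle => // p; case: asboolP => // pO [At pt].
  by split=> //; exact: pO.
apply: bigcupT_measurable => j; case: unpickle => // p.
by case: asboolP.
Qed.

Lemma vmeasurableS A (A' : set R) u : measurable A -> A' `<=` A ->
  vmeasurable c A u -> vmeasurable c A' u.
Proof. by move=> mA AA' mu_ i; apply: (measurable_funS mA AA'). Qed.

Lemma vmeasurableB A u w : vmeasurable c A u -> vmeasurable c A w ->
  vmeasurable c A (fun t => u t - w t).
Proof.
move=> mu_ mw i; rewrite (_ : _ \o _ = (c i \o u) \- (c i \o w)).
  exact: measurable_funB.
by apply/funext => t /=; rewrite coordB.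
Qed.

Lemma vintegrable_vmeasurable A u : vintegrable c A u -> vmeasurable c A u.
Proof. by move=> iu i; have /integrableP[/measurable_EFinP] := iu i. Qed.

Lemma vintegrableS A (A' : set R) u : measurable A -> measurable A' -> A' `<=` A ->
  vintegrable c A u -> vintegrable c A' u.
Proof. by move=> mA mA' AA' iu i; apply: integrableS (iu i). Qed.

Lemma vintegrableB A u w : measurable A -> vintegrable c A u -> vintegrable c A w ->
  vintegrable c A (fun t => u t - w t).
Proof.
move=> mA iu iw i.
rewrite (_ : EFin \o _ = (EFin \o (c i \o u)) \- (EFin \o (c i \o w)))%E.
  exact: integrableB.
by apply/funext => t /=; rewrite coordB.
Qed.

Lemma vintegralB A u w : measurable A -> vintegrable c A u -> vintegrable c A w ->
  vintegral b c A (fun t => u t - w t) = vintegral b c A u - vintegral b c A w.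
Proof.
move=> mA iu iw; rewrite /vintegral -sumrB; apply: eq_bigr => i _.
rewrite -scalerBl -RintegralB//; [|exact: iu|exact: iw].
by congr (_ *: _); apply: eq_Rintegral => t _; rewrite coordB.
Qed.

Lemma vintegral_setU A (B : set R) u : measurable A -> measurable B ->
  vintegrable c (A `|` B) u -> [disjoint A & B] ->
  vintegral b c (A `|` B) u = vintegral b c A u + vintegral b c B u.
Proof.
move=> mA mB iu AB; rewrite /vintegral -big_split; apply: eq_bigr => i _ /=.
by rewrite Rintegral_setU ?scalerDl//; exact: iu.
Qed.

Lemma vintegrable_dom A u phi : measurable A -> vmeasurable c A u ->
  mu.-integrable A (EFin \o phi) -> (forall t, A t -> 0 <= phi t) ->
  {ae mu, forall t, A t -> `|u t| <= phi t} -> vintegrable c A u.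
Proof.
move=> mA mu_ iphi phi0 uphi i; have [C0 _ _ cb] := bc.
have iC : mu.-integrable A (fun t => C%:E * (phi t)%:E)%E by exact: integrableZl.
apply/integrableP; split; first by apply/measurable_EFinP; exact: mu_.
move/integrableP : (iC) => [mC /=]; apply: le_lt_trans.
apply: ae_ge0_le_integral => //.
- by apply/measurable_EFinP; apply: measurableT_comp => //; exact: mu_.
- apply/measurable_EFinP; apply: measurableT_comp => //.
  exact/measurable_EFinP.
- apply: filterS uphi => t uphi At; rewrite /= lee_fin (le_trans (cb _ _))//.
  by rewrite normrM gtr0_norm// ler_wpM2l ?(ltW C0)// (le_trans (uphi At))// ler_norm.
Qed.

Lemma le_norm_vintegral A u phi : measurable A -> vmeasurable c A u ->
  mu.-integrable A (EFin \o phi) -> (forall t, A t -> 0 <= phi t) ->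
  {ae mu, forall t, A t -> `|u t| <= phi t} ->
  `|vintegral b c A u| <= coord_norm * \int[mu]_(t in A) phi t.
Proof.
move=> mA mu_ iphi phi0 uphi; have [C0 _ _ cb] := bc.
have iu := vintegrable_dom mA mu_ iphi phi0 uphi.
have I0 : 0 <= \int[mu]_(t in A) phi t by exact: Rintegral_ge0.
have iC : mu.-integrable A (fun t => C%:E * (phi t)%:E)%E by exact: integrableZl.
have ci i : `|\int[mu]_(t in A) c i (u t)| <= C * \int[mu]_(t in A) phi t.
  apply: (@le_trans _ _ (\int[mu]_(t in A) `|c i (u t)|)).
    by apply: le_normr_Rintegral => //; exact: iu.
  rewrite -RintegralZl// -lee_fin /Rintegral !fineK.
  - apply: ae_ge0_le_integral => //.
    + have := vintegrable_vmeasurable iu i => mcu.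
      by apply/measurable_EFinP; apply: measurableT_comp.
    + by move=> t At; rewrite lee_fin mulr_ge0 ?(ltW C0)// phi0.
    + by move/integrableP : iC => [].
    + apply: filterS uphi => t uphi At; rewrite lee_fin (le_trans (cb _ _))//.
      by rewrite ler_wpM2l ?(ltW C0)// uphi.
  - exact: integrable_fin_num.
  - apply: integrable_fin_num => //.
    rewrite (_ : (fun _ => _) = abse \o (EFin \o (c i \o u))); last exact/funext.
    exact: integrable_abse.
apply: (le_trans (ler_norm_sum _ _ _)).
apply: (@le_trans _ _ (\sum_(i < n) C * (\int[mu]_(t in A) phi t) * `|b i|)).
  by apply: ler_sum => i _; rewrite normrZ ler_wpM2r.
by rewrite -mulr_sumr mulrAC ler_wpM2r// lerDl.
Qed.

End vector_integral.

Section vector_primitive.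
Context {R : realType} {X : normedModType R} {n : nat} (T : \bar R).
Context (b : 'I_n -> X) (c : 'I_n -> X -> R) (C : R).
Hypothesis bc : bounded_coordinates b c C.
Notation mu := (@lebesgue_measure R).
Local Notation D := (horizon T).

Lemma vprimitive_abs_continuous (u : R -> X) :
  (forall s, D s -> vintegrable c `[0, s] u) ->
  abs_continuous D (fun t => vintegral b c `[0, t] u).
Proof.
move=> iu; apply: abs_continuous_sum => i; apply: abs_continuousZ.
by apply: primitive_abs_continuous => s Ds; exact: iu.
Qed.

Lemma vprimitive_ae_derivative (u : R -> X) : (0 < T)%E ->
  (forall s, D s -> vintegrable c `[0, s] u) ->
  {ae mu, forall t, D t ->
    h^-1 *: (vintegral b c `[0, h + t] u - vintegral b c `[0, t] u)
      @[h --> 0^'] --> u t}.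
Proof.
move=> T0 iu; have [_ cE _ _] := bc.
have /filter_forall : forall i : 'I_n, {ae mu, forall t, D t ->
    h^-1 *: ((\int[mu]_(s in `[0, h + t]) c i (u s)) -
             (\int[mu]_(s in `[0, t]) c i (u s)) : R^o)
      @[h --> 0^'] --> (c i (u t) : R^o)}.
  by move=> i; apply: primitive_ae_derivative => // s Ds; exact: iu.
apply: filterS => t h Dt; rewrite [X in _ --> X](cE (u t)).
rewrite (_ : (fun _ => _) = fun h => \sum_(i < n)
   (h^-1 *: ((\int[mu]_(s in `[0, h + t]) c i (u s)) -
             (\int[mu]_(s in `[0, t]) c i (u s)) : R^o)) *: b i).
  apply: cvg_big => [|i _]; first exact: add_continuous.
  by apply: cvgZr_tmp; exact: h.
apply/funext => r; rewrite /vintegral -sumrB scaler_sumr.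
by apply: eq_bigr => i _; rewrite -scalerBl scalerA.
Qed.

End vector_primitive.

(** * Weights *)

Section monotone.
Context {R : realType}.

(** The preimage of a ray [[r, +oo[] in [D] is an interval. *)
Lemma nondecreasing_on_measurable (D : set R) (f : R -> R) : is_interval D ->
  {in D &, {homo f : s t / s <= t}} -> measurable_fun D f.
Proof.
move=> iD fD.
have mD : measurable D by exact: is_interval_measurable.
apply: (measurability (@RGenCInfty.G R)) => [|/= _ [_] [r] -> <-].
  exact: RGenCInfty.measurableE.
apply: is_interval_measurable => s t [Ds fs] [Dt ft] u /andP[su ut].
have Du : D u by apply: (iD s t) => //; rewrite su ut.
split=> //; move: fs; rewrite /= !in_itv/= !andbT => /le_trans; apply.
by apply: fD => //; rewrite inE.
Qed.

Lemma nonincreasing_on_measurable (D : set R) (f : R -> R) : is_interval D ->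
  {in D &, {homo f : s t / s <= t >-> t <= s}} -> measurable_fun D f.
Proof.
move=> iD fD; rewrite -[f]opprK; apply: measurableT_comp => //.
by apply: nondecreasing_on_measurable => // s t Ds Dt st; rewrite lerN2; exact: fD.
Qed.

End monotone.

Lemma ge0_integral_bigcup_le d (Y : measurableType d) (R : realType)
    (mu : {measure set Y -> \bar R}) (S : nat -> set Y) (f : Y -> \bar R) (a : \bar R) :
  {homo S : m n / (m <= n)%N >-> m `<=` n} ->
  (forall n, measurable (S n)) -> measurable_fun (\bigcup_n S n) f ->
  (forall x, (\bigcup_n S n) x -> (0 <= f x)%E) ->
  (forall n, (\int[mu]_(x in S n) f x <= a)%E) ->
  (\int[mu]_(x in \bigcup_n S n) f x <= a)%E.
Proof.
move=> Snd mS mf f0 fa.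
have mfS n : measurable_fun (S n) f.
  apply: measurable_funS mf; first exact: bigcupT_measurable.
  exact: bigcup_sup.
have cvgS : (\int[mu]_(x in S i) f x)%E @[i --> \oo] -->
    (\int[mu]_(x in \bigcup_i S i) f x)%E.
  apply: ge0_nondecreasing_set_cvg_integral => //.
  - by move=> m n mn; rewrite subsetEset; exact: Snd.
  - by move=> i x Sx; apply: f0; exists i.
rewrite -(cvg_lim _ cvgS)//; apply: lime_le; last exact: nearW.
by apply/cvg_ex; eexists; exact: cvgS.
Qed.

Lemma integrable_cst_fin d (Y : measurableType d) (R : realType)
    (mu : {measure set Y -> \bar R}) (A : set Y) (a : R) :
  measurable A -> (mu A < +oo)%E -> mu.-integrable A (EFin \o cst a).
Proof.
move=> mA Afin; apply: measurable_bounded_integrable => //.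
by exists `|a|; split=> // M aM t _; exact: ltW.
Qed.

(** * Level sets of the primitive of a rate *)

Section primitive_levels.
Context {R : realType} (T : \bar R) (T0 : (0 < T)%E).
Notation mu := (@lebesgue_measure R).
Local Notation D := (horizon T).

Lemma horizon_interval : is_interval D.
Proof.
move=> s t [s0 sT] [t0 tT] u /andP[su ut].
by apply: (@horizon_le _ _ _ t) => //; exact: le_trans su.
Qed.

Context (k : R -> R).
Hypothesis mk : measurable_fun D k.
Hypothesis k1 : forall t, D t -> 1 <= k t.
Hypothesis ik : forall s, D s -> mu.-integrable `[0, s] (EFin \o k).
Local Notation A := (fun t => \int[mu]_(s in `[0, t]) k s).

Lemma primitive0 : A 0 = 0.
Proof. by rewrite /= set_itv1 Rintegral_set1. Qed.

(** Here [k >= 1] enters: the primitive grows at least as fast as time, so it is strictly increasing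
    and its bounded level sets are bounded in time. *)
Lemma primitive_increment (s t : R) : 0 <= s -> s <= t -> D t -> t - s <= A t - A s.
Proof.
move=> s0 st Dt; rewrite (Rintegral_itv_increment s0 st (ik Dt)).
have sub : `]s, t] `<=` `[0, t] by apply: subset_itv; rewrite bnd_simp.
have -> : t - s = \int[mu]_(r in `]s, t]) 1.
  rewrite Rintegral_cst//= lebesgue_measure_itv/= lte_fin mul1r.
  by case: ltP => //= ts; rewrite (_ : t = s) ?subrr//; apply/eqP; rewrite eq_le ts.
apply: le_Rintegral => //.
- apply: integrable_cst_fin => //.
  rewrite [ltLHS](_ : _ = mu `]s, t]%classic)// lebesgue_measure_itv/=.
  by case: ifP; rewrite ltry.
- by apply: integrableS (ik Dt).
- by move=> r /sub rI; apply: k1; exact: horizon_itvcc Dt _ rI.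
Qed.

Lemma primitive_homo : {in D &, {homo A : s t / s <= t}}.
Proof.
move=> s t; rewrite !inE => -[s0 _] Dt st.
by rewrite -subr_ge0; apply: le_trans (primitive_increment s0 st Dt); rewrite subr_ge0.
Qed.

Lemma primitive_mono (s t : R) : D s -> D t -> A s <= A t -> s <= t.
Proof.
move=> Ds Dt; apply: contra_le => ts; rewrite -subr_gt0.
have [t0 _] := Dt.
by apply: lt_le_trans (primitive_increment t0 (ltW ts) Ds); rewrite subr_gt0.
Qed.

Lemma primitive_ge (t : R) : D t -> t <= A t.
Proof.
move=> Dt; have [t0 _] := Dt.
by have := primitive_increment (lexx 0) t0 Dt; rewrite primitive0 !subr0.
Qed.

Lemma primitive_measurable : measurable_fun D A.
Proof. exact: nondecreasing_on_measurable horizon_interval primitive_homo. Qed.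

Lemma measurable_level (a b : R) : measurable (D `&` [set t | (a <= A t < b)%R]).
Proof.
rewrite (_ : [set t | _] = A @^-1` `[a, b[%classic); last first.
  by apply/seteqP; split=> t /=; rewrite in_itv.
by apply: primitive_measurable => //; exact: measurable_horizon.
Qed.

(** Within [0, s n] the level set lies in [ta, tb], where the primitive takes the values a and b cut
    off at A (s n); the integral of [k] there is A tb - A ta <= b - a. Monotone convergence in n
    then covers all of [D]. *)
Lemma integral_level_le (a b : R) : 0 <= a -> a <= b ->
  (\int[mu]_(t in D `&` [set t | (a <= A t < b)%R]) (k t)%:E <= (b - a)%:E)%E.
Proof.
move=> a0 ab.
have [s [sD shomo sT]] := horizon_exhaustion T0.
have -> : D `&` [set t | (a <= A t < b)%R] =
    \bigcup_n (D `&` [set t | (a <= A t < b)%R] `&` `[0, s n]).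
  rewrite -setI_bigcupr; apply/esym/setIidPl => t [Dt _].
  have [n tn] := sT _ Dt; exists n => //=; rewrite in_itv/= (ltW tn) andbT.
  by case: Dt.
apply: ge0_integral_bigcup_le.
- move=> m n mn t [? tI]; split=> //; move: tI; rewrite /= !in_itv/= => /andP[-> tm].
  by rewrite (le_trans tm)// shomo.
- by move=> n; apply: measurableI => //; exact: measurable_level.
- apply/measurable_EFinP; apply: measurable_funS mk; first exact: measurable_horizon.
  by move=> t [n _ [[]]].
- by move=> t [n _ [[Dt _] _]]; rewrite lee_fin (le_trans ler01)// k1.
move=> n.
have Dn := sD n; have [n0 _] := Dn.
have Acont : {within `[0, s n], continuous A}.
  exact: parameterized_integral_continuous n0 (ik Dn).
have A0n : A 0 <= A (s n).
  by apply: primitive_homo; rewrite ?inE//; exact: horizon_le Dn.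
(* The cut-off is there because the level v may not be reached before s n. *)
have ivt v : 0 <= v -> exists2 t, `[0, s n]%classic t & A t = Num.min v (A (s n)).
  move=> v0; have [|t tI tv] := IVT n0 Acont (v := Num.min v (A (s n))).
    rewrite min_l// max_r// primitive0 le_min v0 -{1}primitive0 A0n/=.
    by rewrite ge_min lexx orbT.
  by exists t.
have [ta taI Ata] := ivt a a0.
have [tb tbI Atb] := ivt b (le_trans a0 ab).
have Dta : D ta by exact: horizon_itvcc Dn _ taI.
have Dtb : D tb by exact: horizon_itvcc Dn _ tbI.
have tab : ta <= tb.
  by apply: primitive_mono => //; rewrite Ata Atb le_min ge_min ab ge_min lexx orbT.
have sub : D `&` [set t | (a <= A t < b)%R] `&` `[0, s n] `<=` `[ta, tb].
  move=> t [[Dt /= /andP[at_ tb_]]]; rewrite /= !in_itv/= => /andP[t0 tn].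
  have Atn : A t <= A (s n) by apply: primitive_homo; rewrite ?inE.
  apply/andP; split; apply: primitive_mono => //.
    by rewrite Ata ge_min at_.
  by rewrite Atb le_min (ltW tb_).
have sub2 : `[ta, tb] `<=` D.
  apply: subset_trans (horizon_itvcc Dtb); apply: subset_itvr.
  by rewrite bnd_simp; case: Dta.
have mkI : measurable_fun `[ta, tb] k by apply: measurable_funS mk => //; exact: measurable_horizon.
apply: (@le_trans _ _ (\int[mu]_(t in `[ta, tb]) (k t)%:E)%E).
  apply: ge0_subset_integral => //.
  - by apply: measurableI => //; exact: measurable_level.
  - exact/measurable_EFinP.
  - by move=> t /sub2 Dt; rewrite lee_fin (le_trans ler01)// k1.
have [ta0 _] := Dta.
have iI : mu.-integrable `]ta, tb] (EFin \o k).
  by apply: integrableS (ik Dtb) => //; apply: subset_itv; rewrite bnd_simp.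
rewrite -integral_itv_obnd_cbnd; last first.
  by apply/measurable_EFinP; apply: measurable_funS mkI => //; exact: subset_itv_oc_cc.
rewrite -(fineK (integrable_fin_num _ iI))// lee_fin.
rewrite -/(Rintegral mu _ _) -(Rintegral_itv_increment ta0 tab (ik Dtb)) Ata Atb.
rewrite /Num.min; case: ltP => bs; case: ltP => as_ //.
- by have := lt_le_trans bs as_; rewrite ltNge ab.
- by rewrite lerD2r.
- by rewrite subrr subr_ge0.
Qed.

End primitive_levels.

(** * Construction of the weight *)

Section weight.
Context {R : realType} (T : \bar R) (T0 : (0 < T)%E).
Notation mu := (@lebesgue_measure R).
Local Notation D := (horizon T).

(** The running minimum of [r] over [0, t], capped by 1. The cap keeps all arcs within distance 1 of
    z, where the Lipschitz rate is valid. *)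
Lemma decreasing_minorant (r : R -> R) : {within D, continuous r} ->
  (forall t, D t -> 0 < r t) ->
  exists rho : R -> R,
    [/\ forall t, D t -> 0 < rho t, forall t, D t -> rho t <= Num.min 1 (r t) &
        {in D &, {homo rho : s t / s <= t >-> t <= s}}].
Proof.
move=> rc r0.
have hmin t : exists a, D t ->
    (exists2 s, `[0, t]%classic s & a = r s) /\ forall s, `[0, t]%classic s -> a <= r s.
  have [Dt|nDt] := pselect (D t); last by exists 0.
  have [t0 _] := Dt.
  have rct : {within `[0, t], continuous r}.
    by apply: continuous_subspaceW rc; exact: horizon_itvcc.
  have [s sI smin] := EVT_min t0 rct.
  exists (r s) => _; split; first by exists s.
  by move=> u; exact: smin.
have /choice[a ha] := hmin.
exists (fun t => Num.min 1 (a t)); split=> [t Dt|t Dt|s t].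
- rewrite lt_min ltr01/=; have [[s sI ->] _] := ha t Dt.
  by apply: r0; exact: horizon_itvcc sI.
- rewrite le_min !ge_min lexx/=; apply/orP; right.
  by have [_] := ha t Dt; apply; rewrite /= in_itv/= lexx andbT; case: Dt.
- rewrite !inE => Ds Dt st; rewrite le_min !ge_min lexx/=; apply/orP; right.
  have [[u uI ->] _] := ha s Ds; have [_] := ha t Dt; apply.
  by move: uI; rewrite /= !in_itv/= => /andP[-> us]; exact: le_trans st.
Qed.

Context (k : R -> R).
Hypothesis mk : measurable_fun D k.
Hypothesis k1 : forall t, D t -> 1 <= k t.
Hypothesis ik : forall s, D s -> mu.-integrable `[0, s] (EFin \o k).
Local Notation A := (fun t => \int[mu]_(s in `[0, t]) k s).

(* The weight rho * 2 ^- floor (A / q'), a discretized rho * exp (- A / q'):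
   the integral of k over each level set of the floor is at most q'. *)
Lemma exists_weight (rho : R -> R) (q : R) : 0 < q ->
  (forall t, D t -> 0 < rho t) -> {in D &, {homo rho : s t / s <= t >-> t <= s}} ->
  exists p : R -> R,
    [/\ forall t, D t -> 0 < p t, forall t, D t -> p t <= rho t,
        {in D &, {homo p : s t / s <= t >-> t <= s}} &
        forall t, D t ->
          (\int[mu]_(s in D `&` `[t, +oo[) (k s * p s)%:E <= (q * p t)%:E)%E].
Proof.
move=> q0 rho0 rhod.
(* Each level of [N] carries an integral of [k] of at most q / 2; summing over the levels with ratio
   1 / 2 doubles this to q. *)
pose lam := 2 / q; have lam0 : 0 < lam by rewrite divr_gt0.
pose N t := Num.truncn (lam * A t).
pose p t := rho t * 2^-1 ^+ N t.
have A0 t : D t -> 0 <= A t.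
  by move=> Dt; apply: le_trans (primitive_ge k1 ik Dt); case: Dt.
have Nd s t : D s -> D t -> s <= t -> (N s <= N t)%N.
  move=> Ds Dt st; apply: le_truncn; rewrite ler_pM2l//.
  by apply: (primitive_homo k1 ik); rewrite ?inE.
have half0 m : 0 < 2^-1 ^+ m :> R by rewrite exprn_gt0// invr_gt0.
have p0 t : D t -> 0 < p t by move=> Dt; rewrite mulr_gt0// rho0.
have pd : {in D &, {homo p : s t / s <= t >-> t <= s}}.
  move=> s t; rewrite !inE => Ds Dt st; apply: ler_pM; [exact/ltW/rho0|exact/ltW| |].
    by apply: rhod; rewrite ?inE.
  by apply: ler_wiXn2l; [rewrite invr_ge0|rewrite invf_le1// ler1n|exact: Nd].
exists p; split=> // [t Dt|t Dt].
  rewrite ger_pMr ?rho0// exprn_ile1// ?invr_ge0//.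
  by rewrite invf_le1// ler1n.
have mp : measurable_fun D p.
  apply: nonincreasing_on_measurable pd; exact: horizon_interval.
have mD : measurable D := measurable_horizon T.
have mkp : measurable_fun D (fun s => (k s * p s)%:E).
  by apply/measurable_EFinP; exact: measurable_funM.
have kp0 s : D s -> 0 <= k s * p s.
  by move=> Ds; rewrite mulr_ge0 ?(ltW (p0 _ Ds))// (le_trans ler01)// k1.
(* The part of the tail after t lying in the first j levels counted from that of t. It grows with j
   and exhausts the tail; the factor 2 - 2 * 2^-j in [H] is the sum of 2^-i for i < j. *)
pose S j := D `&` [set s | ((N t)%:R / lam <= A s < (N t + j)%:R / lam)%R] `&` `[t, +oo[.
have mS j : measurable (S j).
  by apply: measurableI => //; exact: (measurable_level k1 ik).
have SD j : S j `<=` D by move=> s [[]].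
have -> : D `&` `[t, +oo[ = \bigcup_j S j.
  apply/seteqP; split=> s; last by move=> [j _ [[Ds _] st]].
  move=> [Ds st]; exists (Num.truncn (lam * A s)).+1 => //; split=> //; split=> //=.
  move: st; rewrite /= in_itv/= andbT => st.
  rewrite ler_pdivrMr// mulrC ltr_pdivlMr// (mulrC (A s)).
  apply/andP; split.
    apply: (@le_trans _ _ (lam * A t)).
      by rewrite truncn_le mulr_ge0 ?(ltW lam0)// A0.
    by rewrite ler_pM2l//; apply: (primitive_homo k1 ik); rewrite ?inE.
  apply: (lt_le_trans (Num.Theory.truncnS_gt _)).
  by rewrite ler_nat leq_addl.
apply: ge0_integral_bigcup_le => //.
- move=> i j ij s [[Ds /= /andP[As sA]] st]; split=> //; split=> //=; rewrite As/=.
  by apply: lt_le_trans sA _; rewrite ler_pM2r ?invr_gt0// ler_nat leq_add2l.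
- by apply: measurable_funS mkp => // s [j _ /SD].
- by move=> s [j _ /SD Ds]; rewrite lee_fin; exact: kp0.
suff H j : (\int[mu]_(s in S j) (k s * p s)%:E <=
    (rho t * 2^-1 ^+ N t / lam * (2 - 2 * 2^-1 ^+ j))%:E)%E.
  move=> j; apply: (le_trans (H j)); rewrite lee_fin -/(p t) /lam invf_div.
  rewrite mulrBr.
  have -> : p t * (q / 2) * 2 = q * p t by rewrite mulrC mulrCA (mulrC 2) divfK// mulrC.
  rewrite lerBlDr lerDl !mulr_ge0 ?(ltW (p0 _ Dt)) ?(ltW q0) ?(ltW (half0 _)) ?(ltW (rho0 _ Dt))//.
elim: j => [|j IH].
  rewrite (_ : S 0%N = set0) ?integral_set0 ?expr0 ?mulr1 ?subrr ?mulr0//.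
  apply/seteqP; split=> // s [[_ /= /andP[h1 h2]] _].
  by move: (le_lt_trans h1 h2); rewrite addn0 ltxx.
pose J := D `&` [set s | ((N t + j)%:R / lam <= A s < (N t + j).+1%:R / lam)%R] `&` `[t, +oo[.
have mJ : measurable J by apply: measurableI => //; exact: (measurable_level k1 ik).
have JD : J `<=` D by move=> s [[]].
have Sj : S j.+1 = S j `|` J.
  apply/seteqP; split=> s.
    move=> [[Ds /= /andP[h1 h2]] st].
    have [h|h] := ltP (A s) ((N t + j)%:R / lam).
      by left; split=> //; split=> //=; rewrite h1.
    by right; split=> //; split=> //=; rewrite h -addnS.
  case=> -[[Ds /= /andP[h1 h2]] st]; split=> //; split=> //=; apply/andP; split=> //.
  - by apply: (lt_le_trans h2); rewrite ler_pM2r ?invr_gt0// ler_nat addnS.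
  - by apply: le_trans h1; rewrite ler_pM2r ?invr_gt0// ler_nat leq_addr.
  - by rewrite addnS.
rewrite Sj ge0_integral_setU//; first last.
- apply/disj_set2P/seteqP; split=> // s [[[_ /= /andP[_ h]] _] [[_ /= /andP[h' _]] _]].
  by move: (le_lt_trans h' h); rewrite ltxx.
- by move=> s; rewrite -Sj => /SD Ds; rewrite lee_fin; exact: kp0.
- by rewrite -Sj; apply: measurable_funS mkp.
- exact: mS.
apply: (@le_trans _ _ ((rho t * 2^-1 ^+ N t / lam * (2 - 2 * 2^-1 ^+ j))%:E +
   (rho t * 2^-1 ^+ (N t + j) / lam)%:E)%E); last first.
  rewrite -EFinD lee_fin exprD exprS le_eqVlt; apply/orP; left; apply/eqP.
  move: (2^-1 ^+ N t) (2^-1 ^+ j) => x y; rewrite [2 * (_ * _)]mulrA mulfV//.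
  by rewrite mul1r; move: (lam^-1) => z; ring.
apply: leeD => //.
have mkJ : measurable_fun J (EFin \o k).
  by apply/measurable_EFinP; apply: measurable_funS mk.
have k0 s : D s -> 0 <= k s by move=> Ds; rewrite (le_trans ler01)// k1.
(* On the added level [p] is at most rho t * 2^-(N t + j), since [rho] is nonincreasing and [N] is
   at least N t + j there; the integral of [k] over it is at most 1 / lam. *)
apply: (@le_trans _ _ (\int[mu]_(s in J) ((rho t * 2^-1 ^+ (N t + j))%:E * (k s)%:E))%E).
  apply: ge0_le_integral => //.
  - by move=> s /JD Ds; rewrite lee_fin; exact: kp0.
  - by apply: measurable_funS mkp.
  - by apply: measurable_funeM.
  - move=> s [[Ds /= /andP[h1 h2]] st]; rewrite -EFinM lee_fin mulrC.
    rewrite ler_wpM2r ?k0//; apply: ler_pM; [exact/ltW/rho0|exact/ltW| |].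
      by apply: rhod; rewrite ?inE//; move: st; rewrite /= in_itv/= andbT.
    apply: ler_wiXn2l; [by rewrite invr_ge0|by rewrite invf_le1// ler1n|].
    rewrite truncn_ge_nat; last by apply: mulr_ge0; [exact: ltW|exact: A0].
    by move: h1; rewrite ler_pdivrMr// mulrC.
have c0 : 0 <= rho t * 2^-1 ^+ (N t + j) by rewrite mulr_ge0// ltW// rho0.
have -> : (\int[mu]_(s in J) ((rho t * 2^-1 ^+ (N t + j))%:E * (k s)%:E) =
    (rho t * 2^-1 ^+ (N t + j))%:E * \int[mu]_(s in J) (k s)%:E)%E.
  by apply: ge0_integralZl_EFin => // s /JD Ds; rewrite lee_fin k0.
rewrite [leRHS]EFinM; apply: lee_wpmul2l; first by rewrite lee_fin.
apply: (@le_trans _ _ (\int[mu]_(s in D `&` [set s |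
    ((N t + j)%:R / lam <= A s < (N t + j).+1%:R / lam)%R]) (k s)%:E)%E).
  apply: ge0_subset_integral => //.
  - exact: (measurable_level k1 ik).
  - by apply/measurable_EFinP; apply: measurable_funS mk => // s [].
  - by move=> s [Ds _]; rewrite lee_fin k0.
  - by move=> s [].
apply: (le_trans (integral_level_le T0 mk k1 ik _ _)).
- by rewrite divr_ge0// ltW.
- by rewrite ler_pM2r ?invr_gt0// ler_nat.
- by rewrite lee_fin -mulrBl -natrB// subSnn mul1r.
Qed.

End weight.

(** * Chattering *)

Section splitting.
Context {R : realType}.
Notation mu := (@lebesgue_measure R).

(** A preimage is a countable union of fibres of [key], whatever [F] is. *)
Lemma measurable_fun_countable_key d (Y : measurableType d) (I : countType)
    (D : set R) (key : R -> I) (F : I -> Y) :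
  (forall i, measurable (D `&` key @^-1` [set i])) ->
  measurable_fun D (F \o key).
Proof.
move=> mkey mD B mB.
rewrite (_ : _ `&` _ = \bigcup_n (if unpickle n is Some i then
   if `[< B (F i) >] then D `&` key @^-1` [set i] else set0 else set0)).
  apply: bigcupT_measurable => n; case: unpickle => // i.
  by case: asboolP => _ //; exact: mkey.
apply/seteqP; split=> t.
  move=> [Dt Bt]; exists (pickle (key t)) => //; rewrite pickleK.
  by case: asboolP.
move=> [n _]; case: unpickle => // i; case: asboolP => // BFi [Dt /= ti].
by split=> //=; rewrite ti.
Qed.

(** Intermediate value theorem for the measure of the part of [E] up to s, which is continuous in s
    as the primitive of an indicator. *)
Lemma measurable_cut (E : set R) (M v : R) : measurable E -> 0 <= M ->
  E `<=` `[0, M] -> (0 <= v%:E <= mu E)%E ->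
  exists s, mu (E `&` `]-oo, s]) = v%:E.
Proof.
move=> mE M0 EM /andP[v0 vE].
pose f : R -> R := \1_E.
have fi : mu.-integrable `[0, M] (EFin \o f).
  apply: measurable_bounded_integrable => //.
  - rewrite [ltLHS](_ : _ = mu `[0, M]%classic)// lebesgue_measure_itv/=.
    by case: ifP; rewrite ltry.
  - by apply: (measurable_funS (E := setT)) => //; exact: measurable_indic.
  - exists 1; split=> // y y1 t _ /=; rewrite (le_trans _ (ltW y1))// /f indicE.
  by rewrite ger0_norm// lern1 leq_b1.
have fE s : s <= M -> \int[mu]_(t in `[0, s]) f t = fine (mu (E `&` `]-oo, s])).
  move=> sM; rewrite /Rintegral/f integral_indic//; congr (fine (mu _)).
  apply/seteqP; split=> t /= [Et]; rewrite !in_itv/= => ts; split=> //.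
    by case/andP : ts.
  by have := EM _ Et; rewrite /= in_itv/= => /andP[->].
have fc : {within `[0, M], continuous (fun s => \int[mu]_(t in `[0, s]) f t)}.
  exact: parameterized_integral_continuous.
have EME : E `&` `]-oo, M] = E.
  by apply/setIidPl => t /EM; rewrite /= !in_itv/= => /andP[].
have Efin : (mu E < +oo)%E.
  apply: (@le_lt_trans _ _ (mu `[0, M]%classic)); first by apply: le_measure; rewrite ?inE.
  by rewrite lebesgue_measure_itv/=; case: ifP; rewrite ltry.
have [|s sI sv] := IVT M0 fc (v := v).
  rewrite set_itv1 Rintegral_set1 fE// EME.
  move: v0 vE; rewrite -(fineK (x := mu E)) ?ge0_fin_numE// !lee_fin => v0 vE.
  by rewrite min_l ?(le_trans v0)// max_r ?(le_trans v0)// v0.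
exists s; rewrite -sv fE; last by move: sI; rewrite in_itv/= => /andP[].
rewrite fineK// ge0_fin_numE//; apply: le_lt_trans Efin.
by apply: le_measure; rewrite ?inE//; exact: measurableI.
Qed.

(** By induction: a part of measure mu E / (N + 2) is cut off and receives the index N + 1, the rest
    is split into N + 1 equal parts, and (1 - 1 / (N + 2)) / (N + 1) = 1 / (N + 2). *)
Lemma equal_measure_split (E : set R) (M : R) (N : nat) : measurable E -> 0 <= M ->
  E `<=` `[0, M] ->
  exists pi : R -> nat, [/\ forall i, measurable (pi @^-1` [set i]),
    forall t, (pi t <= N)%N &
    forall i, (i <= N)%N -> mu (E `&` pi @^-1` [set i]) = (N.+1%:R^-1%:E * mu E)%E].
Proof.
elim: N E => [|N IH] E mE M0 EM.
  exists (fun=> 0%N); split=> // [i|[|i]// _]; last first.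
    by rewrite (_ : _ @^-1` _ = setT) ?setIT ?invr1 ?mul1e//; exact/seteqP.
  have [->|i0] := eqVneq i 0%N.
    by rewrite (_ : _ @^-1` _ = setT)//; exact/seteqP.
  rewrite (_ : _ @^-1` _ = set0)//; apply/seteqP; split=> // t /= ti.
  by move: i0; rewrite -ti.
have Efin : (mu E < +oo)%E.
  apply: (@le_lt_trans _ _ (mu `[0, M]%classic)); first by apply: le_measure; rewrite ?inE.
  by rewrite lebesgue_measure_itv/=; case: ifP; rewrite ltry.
have Efn : mu E \is a fin_num by rewrite ge0_fin_numE.
pose m := fine (mu E); have mE' : mu E = m%:E by rewrite fineK.
have m0 : 0 <= m by rewrite fine_ge0.
have [|s sv] := @measurable_cut E M (N.+2%:R^-1 * m) mE M0 EM.
  rewrite mE' !lee_fin mulr_ge0//= ler_piMl// invf_le1// ler1n//.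
pose E' := E `&` `]s, +oo[.
have mE1 : measurable E' by exact: measurableI.
have [|pi [mpi pile pimu]] := IH E' mE1 M0; first by apply: subset_trans EM; exact: subIsetl.
have EE' : E = (E `&` `]-oo, s]) `|` E'.
  rewrite /E' -setIUr; apply/esym/setIidPl => t _ /=; rewrite !in_itv/= andbT.
  by have [] := leP t s; [left|right].
have muE' : mu E' = (m - N.+2%:R^-1 * m)%:E.
  have : mu E = (mu (E `&` `]-oo, s]) + mu E')%E.
    rewrite [in LHS]EE' measureU//; first exact: measurableI.
    apply/seteqP; split=> // t [[_ /= ts] [_ /=]].
    by move: ts; rewrite !in_itv/= andbT leNgt => /negP.
  rewrite sv mE' => h; rewrite EFinB h [X in (X - _)%E]addeC addeK//.
exists (fun t => if t <= s then N.+1 else pi t); split=> [i|t|i iN].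
- rewrite (_ : _ @^-1` _ = (if i == N.+1 then `]-oo, s]%classic else set0) `|`
     (`]s, +oo[ `&` pi @^-1` [set i])); last first.
    apply/seteqP; split=> t /=; rewrite !in_itv/= andbT; case: leP => ts.
    + by move=> <-; rewrite eqxx; left; rewrite /= in_itv.
    + by move=> <-; right.
    + by case=> [|[]//]; case: eqP.
    + by case=> [|[]//]; case: eqP => //= _; rewrite in_itv/= leNgt ts.
  apply: measurableU; first by case: ifP.
  by apply: measurableI => //; exact: measurable_itv.
- by case: leP => // _; exact: leq_trans (pile t) _.
- move: iN; rewrite leq_eqVlt => /predU1P[->|iN].
    rewrite (_ : _ `&` _ = E `&` `]-oo, s]); first by rewrite sv mE'.
    apply/seteqP; split=> t /= [Et]; rewrite in_itv/=; case: leP => // ts.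
    by move=> piN; move: (pile t); rewrite piN ltnn.
  rewrite (_ : _ `&` _ = E' `&` pi @^-1` [set i]).
    rewrite pimu// muE' mE' -!EFinM; congr (_%:E).
    rewrite -[X in X - _]mul1r -mulrBl mulrA; congr (_ * _).
    have N1 : N.+1%:R != 0 :> R by rewrite pnatr_eq0.
    have N2 : N.+2%:R != 0 :> R by rewrite pnatr_eq0.
    apply: (mulfI N1); rewrite mulVKf//; apply: (mulfI N2).
    by rewrite mulrBr mulr1 mulfV// mulrCA mulfV// mulr1 -natr1 addrK.
  apply/seteqP; split=> t /=.
    move=> [Et]; case: leP => [_ iN1|ts <-].
      by move: iN; rewrite -iN1 ltnn.
    by split=> //; split=> //=; rewrite in_itv/= ts.
  move=> [[Et]]; rewrite /= in_itv/= andbT => ts <-; split=> //.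
  by case: leP ts.
Qed.

End splitting.

Lemma ge0_integrable_le d (Y : measurableType d) (R : realType)
    (mu : {measure set Y -> \bar R}) (S : set Y) (f : Y -> R) (a : R) :
  measurable S -> measurable_fun S f -> (forall s, S s -> 0 <= f s) ->
  (\int[mu]_(s in S) (f s)%:E <= a%:E)%E -> mu.-integrable S (EFin \o f).
Proof.
move=> mS mf f0 fa; apply/integrableP; split; first exact/measurable_EFinP.
apply: (@le_lt_trans _ _ a%:E); last by rewrite ltry.
rewrite (eq_integral (EFin \o f))// => s; rewrite inE => Ss /=.
by rewrite ger0_norm// f0.
Qed.

(** * Chattering between the terms of an average *)

Section chattering.
Context {R : realType} {X : normedModType R} {n : nat} (T : \bar R) (T0 : (0 < T)%E).
Context (b : 'I_n -> X) (c : 'I_n -> X -> R) (C : R).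
Hypothesis bc : bounded_coordinates b c C.
Notation mu := (@lebesgue_measure R).
Local Notation D := (horizon T).
Context (k p : R -> R).
Hypothesis mk : measurable_fun D k.
Hypothesis k1 : forall t, D t -> 1 <= k t.
Hypothesis ik : forall s, D s -> mu.-integrable `[0, s] (EFin \o k).
Hypothesis p0 : forall t, D t -> 0 < p t.
Hypothesis p1 : forall t, D t -> p t <= 1.
Hypothesis pd : {in D &, {homo p : s t / s <= t >-> t <= s}}.

Lemma measurable_inv_weight : measurable_fun D (fun t => (p t)^-1).
Proof.
apply: nondecreasing_on_measurable; first exact: horizon_interval.
move=> s t; rewrite !inE => Ds Dt st; rewrite lef_pV2 ?posrE ?p0//.
by apply: pd; rewrite ?inE.
Qed.

(** On [0, s] the weight, being nonincreasing, is at least p s. *)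
Lemma integrable_div_weight (L : R) : 0 <= L ->
  forall s, D s -> mu.-integrable `[0, s] (EFin \o (fun t => L * (k t / p t))).
Proof.
move=> L0 s Ds.
have sub := horizon_itvcc Ds.
have mD := measurable_horizon T.
have iL : mu.-integrable `[0, s] (fun t => (L / p s)%:E * (k t)%:E)%E.
  by apply: integrableZl => //; exact: ik.
apply: le_integrable iL => //.
  apply/measurable_EFinP; apply: (@measurable_funS _ _ _ _ D) => //.
  apply: measurable_funM => //; apply: measurable_funM => //.
  exact: measurable_inv_weight.
move=> t tI; have Dt := sub _ tI.
have kt : 0 <= k t by rewrite (le_trans ler01)// k1.
rewrite /= lee_fin !ger0_norm ?mulr_ge0 ?invr_ge0 ?(ltW (p0 _))//.
rewrite -mulrA ler_wpM2l// mulrC ler_wpM2r//.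
rewrite lef_pV2 ?posrE ?p0//; apply: pd; rewrite ?inE//.
by move: tI; rewrite /= in_itv/= => /andP[].
Qed.

(** The pieces are the unit levels of the primitive of [kap] = L k / p, split further by the value
    of [iota]. As [g - w] has integral 0 over whole pieces, its integral over [0, t] is minus that
    over the rest, after t, of the current level. There p <= p(t), so 4 k <= (4 / L) p(t) kap, and
    the integral of [kap] is at most 1: the error is at most K (4 / L) p(t) <= theta p(t). Using the
    rest after t, not the part before it, makes the monotonicity of [p] act in the right
    direction. *)
Lemma chattering (iota : R -> nat) (q : nat -> nat -> X) (N : nat -> nat)
    (theta : R) : 0 < theta ->
  (forall j, measurable (iota @^-1` [set j])) ->
  {ae mu, forall t, D t ->
    forall i, (i <= N (iota t))%N -> `|q (iota t) i| <= 2 * k t} ->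
  exists idx : R -> nat, let g t := q (iota t) (idx t) in
    let w t := (N (iota t)).+1%:R^-1 *: \sum_(i < (N (iota t)).+1) q (iota t) i in
    [/\ forall t, (idx t <= N (iota t))%N, vmeasurable c D g, vmeasurable c D w &
        forall t, D t -> `|vintegral b c `[0, t] (fun s => g s - w s)| <= theta * p t].
Proof.
move=> theta0 miota qk.
have K0 := coord_norm_gt0 bc.
pose K := coord_norm b C.
(* The summand 1 gives kap >= k >= 1, as p <= 1; the other gives 4 K / L <= theta. *)
pose L := 1 + K * 4 / theta.
have L1 : 1 <= L by rewrite lerDl divr_ge0 ?mulr_ge0// ltW.
have L0 : 0 < L by apply: lt_le_trans L1.
have mD := measurable_horizon T.
pose kap t := L * (k t / p t).
have mkap : measurable_fun D kap.
  by do 2 apply: measurable_funM => //; exact: measurable_inv_weight.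
have k_kap t : D t -> k t <= kap t.
  move=> Dt; have kt : 0 <= k t by rewrite (le_trans ler01)// k1.
  rewrite /kap -[leLHS]mul1r; apply: ler_pM => //.
  by rewrite ler_peMr// invf_ge1 ?p0 ?p1.
have kap1 t : D t -> 1 <= kap t by move=> Dt; apply: le_trans (k_kap _ Dt); exact: k1.
have ikap := integrable_div_weight (ltW L0).
have k0 t : D t -> 0 <= k t by move=> Dt; rewrite (le_trans ler01)// k1.
pose A t := \int[mu]_(s in `[0, t]) kap s.
pose l t := Num.truncn (A t).
have A0 t : D t -> 0 <= A t.
  by move=> Dt; apply: le_trans (primitive_ge kap1 ikap Dt); case: Dt.
have Ahomo s t : D s -> D t -> s <= t -> A s <= A t.
  by move=> Ds Dt; apply: (primitive_homo kap1 ikap); rewrite inE.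
pose I m := D `&` [set t | (m%:R <= A t < m.+1%:R)%R].
pose B m := D `&` [set t | (0 <= A t < m%:R)%R].
have mI m : measurable (I m) by exact: (measurable_level kap1 ikap).
have mB m : measurable (B m) by exact: (measurable_level kap1 ikap).
have IE m : I m = D `&` l @^-1` [set m].
  apply/seteqP; split=> t [Dt h]; split=> //.
    by apply/eqP; rewrite /l truncn_eq ?A0.
  by move: h => /= /eqP; rewrite /l truncn_eq ?A0.
pose E j m := I m `&` iota @^-1` [set j].
have mE j m : measurable (E j m) by exact: measurableI.
have EM j m : E j m `<=` `[0, m.+1%:R].
  move=> t [[Dt /= /andP[_ At]] _]; rewrite in_itv/=; apply/andP; split.
    by case: Dt.
  by apply: (le_trans (primitive_ge kap1 ikap Dt)); exact: ltW.
have /choice[pi0 hpi0] : forall jm : nat * nat, exists pi : R -> nat,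
    [/\ forall i, measurable (pi @^-1` [set i]), forall t, (pi t <= N jm.1)%N &
    forall i, (i <= N jm.1)%N ->
      mu (E jm.1 jm.2 `&` pi @^-1` [set i]) =
      ((N jm.1).+1%:R^-1%:E * mu (E jm.1 jm.2))%E].
  by move=> [j m]; apply: equal_measure_split (EM j m) => //; exact: ler0n.
pose idx t := pi0 (iota t, l t) t.
have idxN t : (idx t <= N (iota t))%N by have [_ h _] := hpi0 (iota t, l t); exact: h.
pose g t := q (iota t) (idx t).
pose wj j := (N j).+1%:R^-1 *: \sum_(i < (N j).+1) q j i.
pose w t := wj (iota t).
(* The level belongs to the key because the splitting that defines [idx] changes with it. *)
pose key t := (iota t, (l t, idx t)).
have mkey a : measurable (D `&` key @^-1` [set a]).
  move: a => [j [m i]].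
  rewrite (_ : _ `&` _ = E j m `&` pi0 (j, m) @^-1` [set i]).
    by apply: measurableI => //; have [] := hpi0 (j, m).
  rewrite /E IE; apply/seteqP; split=> t /=.
    by move=> [Dt [<- <- <-]].
  by move=> [[[Dt lt] ij] pii]; split=> //; rewrite /key /idx ij lt pii.
have mg : vmeasurable c D g.
  move=> i; exact: (measurable_fun_countable_key (fun a => c i (q a.1 a.2.2)) mkey).
have mw : vmeasurable c D w.
  move=> i; exact: (measurable_fun_countable_key (fun a => c i (wj a.1)) mkey).
exists idx; split=> // t Dt; rewrite -/(g _).
pose u s := g s - w s; rewrite -/u.
have mu_ : vmeasurable c D u by exact: (vmeasurableB bc).
have uk : {ae mu, forall s, D s -> `|u s| <= 4 * k s}.
  apply: filterS qk => s qs Ds; have {}qs := qs Ds.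
  apply: (le_trans (ler_normB _ _)).
  rewrite (_ : 4 * k s = 2 * k s + 2 * k s); last by rewrite -mulrDl -natrD.
  apply: lerD; first exact: qs.
  rewrite normrZ ger0_norm ?invr_ge0// mulrC ler_pdivrMr//.
  apply: (le_trans (ler_norm_sum _ _ _)).
  apply: (@le_trans _ _ (\sum_(i < (N (iota s)).+1) 2 * k s)).
    by apply: ler_sum => i _; apply: qs; rewrite -ltnS.
  by rewrite sumr_const card_ord mulr_natr.
have iB (S : set R) a : measurable S -> S `<=` D ->
    (\int[mu]_(s in S) (kap s)%:E <= a%:E)%E -> mu.-integrable S (EFin \o (fun s => 4 * k s)).
  move=> mS SD Sa.
  have ikapS : mu.-integrable S (EFin \o kap).
    apply: ge0_integrable_le Sa => //; first by apply: measurable_funS mkap.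
    by move=> s /SD Ds; rewrite (le_trans ler01)// kap1.
  have : mu.-integrable S (fun s => 4%:E * (kap s)%:E)%E by exact: integrableZl.
  apply: le_integrable => //.
    by apply/measurable_EFinP; apply: measurable_funM => //; apply: measurable_funS mk.
  move=> s /SD Ds /=; have kaps : 0 <= kap s by rewrite (le_trans ler01)// kap1.
  rewrite lee_fin (ger0_norm (mulr_ge0 _ (k0 _ Ds)))// (ger0_norm (mulr_ge0 _ kaps))//.
  by rewrite ler_wpM2l// k_kap.
have iu (S : set R) a : measurable S -> S `<=` D ->
    (\int[mu]_(s in S) (kap s)%:E <= a%:E)%E -> vintegrable c S u.
  move=> mS SD Sa.
  apply: (vintegrable_dom bc mS _ (iB _ _ mS SD Sa)).
  - by apply: vmeasurableS mu_.
  - by move=> s /SD Ds; rewrite mulr_ge0// k0.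
  - by apply: filterS uk => s us /SD.
have BD m : B m `<=` D by move=> s [].
have ID m : I m `<=` D by move=> s [].
have kapI m : (\int[mu]_(s in I m) (kap s)%:E <= (m.+1%:R - m%:R)%:E)%E.
  by apply: integral_level_le => //; rewrite ler_nat.
have kapB m : (\int[mu]_(s in B m) (kap s)%:E <= (m%:R - 0)%:E)%E.
  exact: integral_level_le.
(* On the part with index a, [u] is constant, equal to q j a minus the average [wj j]; the parts
   have equal measure and these differences sum to 0. *)
have uE j m i : (\int[mu]_(s in E j m) (c i (u s))%:E = 0)%E.
  pose P a := E j m `&` pi0 (j, m) @^-1` [set a].
  have [mpi pile pimu0] := hpi0 (j, m).
  have pimu a : (a <= N j)%N -> mu (P a) = ((N j).+1%:R^-1%:E * mu (E j m))%E by exact: pimu0.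
  have mP a : measurable (P a) by exact: measurableI.
  have EP : E j m = \big[setU/set0]_(a <- index_iota 0 (N j).+1) P a.
    apply/seteqP; split=> s; rewrite -bigcup_seq; last by move=> [a _ []].
    move=> Es; exists (pi0 (j, m) s) => //=.
    by rewrite mem_index_iota/= ltnS; exact: pile.
  have muc : measurable_fun (E j m) (c i \o u).
    by apply: measurable_funS (mu_ i) => // r [/ID].
  have Efin : mu (E j m) \is a fin_num.
    rewrite ge0_fin_numE//; apply: (@le_lt_trans _ _ (mu `[0, m.+1%:R]%classic)).
      by apply: le_measure; rewrite ?inE; [exact: mE|exact: measurable_itv|exact: EM].
    by rewrite lebesgue_measure_itv/=; case: ifP; rewrite ltry.
  have := @integral_bigsetU_EFin _ _ _ mu nat P (c i \o u) (index_iota 0 (N j).+1) mP.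
  rewrite -EP => ->.
  - rewrite big_nat_cond (eq_bigr (fun a =>
      ((c i (q j a) - c i (wj j)) * ((N j).+1%:R^-1 * fine (mu (E j m))))%:E)).
      rewrite -big_nat_cond sumEFin -mulr_suml sumrB.
      rewrite sumr_const_nat subn0 big_mkord -(coord_sum bc) /wj (coordZ bc).
      by rewrite -(mulr_natl (_ * _)) mulrA mulfV ?pnatr_eq0// mul1r subrr mul0r.
    move=> a; rewrite andbT => /andP[_ aN].
    rewrite (eq_integral (cst (c i (q j a) - c i (wj j))%:E)).
      rewrite integral_cst/=; last exact: mP.
      by rewrite EFinM; congr (_ * _)%E; rewrite [LHS](pimu a aN) EFinM fineK.
    move=> s; rewrite inE => -[[Is /= ij] pia].
    move: Is; rewrite IE => -[_ /= lm].
    by rewrite /u /g /w /idx (coordB bc) ij lm pia.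
  - by rewrite /index_iota iota_uniq.
  - apply/trivIsetP => a a' _ _ aa'; apply/seteqP; split=> // s [[_ /= pa] [_ /= pa']].
    by move: aa'; rewrite -pa pa' eqxx.
  - exact/measurable_EFinP.
have uI m : vintegral b c (I m) u = 0.
  apply: big1 => i _; rewrite /Rintegral.
  have IEU : I m = \bigcup_j E j m.
    by rewrite /E -setI_bigcupr -preimage_bigcup (_ : \bigcup_j [set j] = setT)
      ?setIT//; apply/seteqP; split=> // j _; exists j.
  rewrite IEU integral_bigcup//.
  - by rewrite eseries0 ?scale0r// => j _ _; exact: uE.
  - move=> j j' _ _ [s [[_ /= <-] [_ /= <-]]]//.
  - by move=> j; exact: mE.
  - by have := iu _ _ (mI m) (ID m) (kapI m) i; rewrite IEU.
have uB m : vintegral b c (B m) u = 0.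
  elim: m => [|m IH].
    rewrite (_ : B 0%N = set0); first by apply: big1 => i _; rewrite Rintegral_set0 scale0r.
    by apply/seteqP; split=> // s [_ /= /andP[h1 h2]]; move: (le_lt_trans h1 h2); rewrite ltxx.
  have BS : B m.+1 = B m `|` I m.
    apply/seteqP; split=> s.
      move=> [Ds /= /andP[h1 h2]]; have [h|h] := ltP (A s) m%:R.
        by left; split=> //=; rewrite h1.
      by right; split=> //=; rewrite h.
    move=> [] [Ds /= /andP[h1 h2]]; split=> //=; apply/andP; split=> //.
    - by apply: lt_trans h2 _; rewrite ltr_nat.
    - exact: A0.
  rewrite BS vintegral_setU// ?IH ?uI ?addr0//.
    by rewrite -BS; exact: (iu _ _ (mB _) (BD _) (kapB _)).
  apply/disj_set2P/seteqP; split=> // s [[_ /= /andP[_ h]] [_ /= /andP[h' _]]].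
  by move: (le_lt_trans h' h); rewrite ltxx.
pose m := l t.
have mt : (m%:R <= A t < m.+1%:R).
  by rewrite -truncn_eq ?A0.
pose Q := B m.+1 `&` `]t, +oo[.
have mQ : measurable Q by exact: measurableI.
have QD : Q `<=` D by move=> s [/BD].
have BQ : B m.+1 = `[0, t] `|` Q.
  apply/seteqP; split=> s.
    move=> Bs; have [Ds _] := Bs; have [ts|st] := ltP t s.
      by right; split=> //=; rewrite in_itv/= ts.
    by left; rewrite /= in_itv/= st; case: Ds => ->.
  move=> [|[]//]; rewrite /= in_itv/= => /andP[s0 st].
  have Ds : D s by exact: horizon_le Dt.
  split=> //=; rewrite A0//=; case/andP: mt => _; apply: le_lt_trans.
  exact: Ahomo.
have QI : Q `<=` I m.
  move=> s [[Ds /= /andP[_ As]]]; rewrite /= in_itv/= andbT => ts; split=> //=.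
  by rewrite As andbT; case/andP: mt => mt _; apply: (le_trans mt); exact: Ahomo (ltW ts).
have kapQ : (\int[mu]_(s in Q) (kap s)%:E <= 1%:E)%E.
  apply: (@le_trans _ _ (\int[mu]_(s in I m) (kap s)%:E)%E).
    apply: ge0_subset_integral; [exact: mQ|exact: mI| | |exact: QI].
      by apply/measurable_EFinP; apply: measurable_funS mkap.
    by move=> s /ID Ds; rewrite lee_fin (le_trans ler01)// kap1.
  by apply: (le_trans (kapI m)); rewrite -natrB// subSnn.
have iuB : vintegrable c (B m.+1) u by exact: (iu _ _ (mB _) (BD _) (kapB _)).
have -> : vintegral b c `[0, t] u = - vintegral b c Q u.
  apply/eqP; rewrite -addr_eq0 -vintegral_setU -?BQ ?uB//.
  apply/disj_set2P/seteqP; split=> // s [/= + [_ /=]].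
  by rewrite !in_itv/= andbT => /andP[_]; rewrite leNgt => /negP.
rewrite normrN.
have i4 := iB _ _ mQ QD kapQ.
have pQ : \int[mu]_(s in Q) (4 * k s) <= 4 / L * p t.
  have ik1 : mu.-integrable Q (EFin \o kap).
    apply: ge0_integrable_le kapQ => //; first by apply: measurable_funS mkap.
    by move=> s /QD Ds; rewrite (le_trans ler01)// kap1.
  have pL0 : 0 <= 4 / L * p t.
    by rewrite mulr_ge0 ?(ltW (p0 _))// divr_ge0// ltW.
  have ik2 : mu.-integrable Q (fun s => (4 / L * p t)%:E * (kap s)%:E)%E.
    exact: integrableZl.
  apply: (@le_trans _ _ (\int[mu]_(s in Q) (4 / L * p t * kap s))).
    apply: le_Rintegral => // s Qs; have Ds := QD _ Qs.
    have ps := p0 Ds.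
    have -> : 4 * k s = 4 / L * p s * kap s.
      by rewrite /kap; field; rewrite !gt_eqF.
    rewrite ler_wpM2r ?(le_trans ler01 (kap1 _ Ds))// ler_wpM2l//.
      by rewrite divr_ge0// ltW.
    apply: pd; rewrite ?inE//; case: Qs => _.
    by rewrite /= in_itv/= andbT => /ltW.
  rewrite RintegralZl// ler_piMr// -lee_fin /Rintegral fineK//.
  exact: integrable_fin_num.
apply: (@le_trans _ _ (K * (4 / L * p t))).
  apply: le_trans (ler_wpM2l (ltW K0) pQ).
  apply: (le_norm_vintegral bc mQ _ i4).
  - by apply: vmeasurableS mu_.
  - by move=> s /QD Ds; rewrite mulr_ge0// k0.
  - by apply: filterS uk => s us /QD.
rewrite !mulrA ler_wpM2r ?(ltW (p0 Dt))// ler_pdivrMr// /L [theta * _]mulrDr mulr1.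
by rewrite [theta * (_ / _)]mulrC divfK ?gt_eqF// lerDr ltW.
Qed.

End chattering.

(** * Approximate selections *)

Section averages.
Context {R : realType} {X : normedModType R}.
Implicit Types (s : seq X) (S : set X).

Definition average s : X := (size s)%:R^-1 *: \sum_(y <- s) y.

Lemma sum_flatten_nseq m s : \sum_(y <- flatten (nseq m s)) y = m%:R *: \sum_(y <- s) y.
Proof.
elim: m => [|m IH]; first by rewrite big_nil scale0r.
by rewrite /= big_cat IH/= -[X in X + _]scale1r -scalerDl addrC natr1.
Qed.

Lemma size_flatten_nseq m s : size (flatten (nseq m s)) = (m * size s)%N.
Proof. by elim: m => //= m IH; rewrite size_cat IH mulSn. Qed.

Lemma mem_flatten_nseq m s y : y \in flatten (nseq m s) -> y \in s.
Proof. by move=> /flattenP[s' /nseqP[-> _]]. Qed.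

(* Averages of lists with repetitions realize all rational convex combinations. *)
Lemma clco_average S v : clco S v -> forall e : R, 0 < e ->
  exists s, [/\ s != [::], forall y, y \in s -> S y & `|v - average s| < e].
Proof.
(* The hull is the smallest closed convex set containing [S], so it suffices that the limits of
   averages form a closed convex set containing [S]. *)
pose P := [set w | forall e : R, 0 < e ->
  exists s, [/\ s != [::], forall y, y \in s -> S y & `|w - average s| < e]].
have clP : closed P.
  move=> w clw e e0.
  have e2 : 0 < e / 2 by rewrite divr_gt0.
  have [w' [Pw']] := clw _ (nbhsx_ballx w _ e2).
  have [s [s0 sS sw]] := Pw' _ e2.
  rewrite -ball_normE/= => ww'; exists s; split=> //.
  by rewrite (splitr e) (le_lt_trans (ler_distD w' _ _))// ltrD.
have cvP : convex_set (P : set (convex_lmodType X)).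
  move=> w1 w2 l; rewrite !inE => Pw1 Pw2 e e0.
  have e2 : 0 < e / 2 by rewrite divr_gt0.
  have [s1 [s10 s1S s1w]] := Pw1 _ e2; have [s2 [s20 s2S s2w]] := Pw2 _ e2.
  have a0 : 0 <= l%:num :> R by []. have a1 : l%:num <= 1 :> R by [].
  pose a : R := l%:num; rewrite -/a in a0 a1.
  have -> : conv l w1 w2 = a *: w1 + (1 - a) *: w2 :> X by [].
  pose B := `|average s1| + `|average s2|.
  have B0 : 0 <= B by rewrite addr_ge0.
  (* The weight a is rounded down to m / M, with error at most 1 / M; [M] is so large that this
     moves the combination of the two averages by less than e / 2. *)
  pose M := (Num.truncn (B / (e / 2))).+1.
  have M0 : 0 < M%:R :> R by rewrite ltr0n.
  have BM : B / M%:R < e / 2.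
    by rewrite ltr_pdivrMr// mulrC -ltr_pdivrMr// Num.Theory.truncnS_gt.
  pose m := Num.truncn (a * M%:R).
  have aM0 : 0 <= a * M%:R by rewrite mulr_ge0// ltW.
  have /andP[m1 m2] : (m%:R <= a * M%:R < m.+1%:R) by rewrite -truncn_eq.
  have mM : (m <= M)%N by rewrite -(ler_nat R) (le_trans m1)// ler_piMl// ltW.
  pose a' := m%:R / M%:R : R.
  have aa' : `|a - a'| <= M%:R^-1.
    rewrite ger0_norm; last by rewrite subr_ge0 ler_pdivrMr.
    by rewrite lerBlDl /a' -[X in _ + X]mul1r -mulrDl natr1 ler_pdivlMr// ltW.
  (* The numbers of copies compensate for the different lengths: of the M |s1| |s2| entries, m |s1|
     |s2| come from s1. *)
  pose s := flatten (nseq (m * size s2) s1) ++ flatten (nseq ((M - m) * size s1) s2).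
  have n1 : (size s1)%:R != 0 :> R by rewrite pnatr_eq0 size_eq0.
  have n2 : (size s2)%:R != 0 :> R by rewrite pnatr_eq0 size_eq0.
  have sE : size s = (M * (size s1 * size s2))%N.
    rewrite size_cat !size_flatten_nseq -!mulnA (mulnC (size s2)) -mulnDl.
    by rewrite subnKC.
  have avgs : average s = a' *: average s1 + (1 - a') *: average s2.
    rewrite {1}/average sE big_cat/= !sum_flatten_nseq scalerDr !scalerA.
    rewrite !natrM natrB// /a'; congr (_ *: _ + _ *: _).
      by field; rewrite n1 n2 gt_eqF.
    by field; rewrite n1 n2 gt_eqF.
  exists s; split.
  - by rewrite -size_eq0 sE !muln_eq0 !size_eq0 (negbTE s10) (negbTE s20).
  - by move=> y; rewrite mem_cat => /orP[] /mem_flatten_nseq; [exact: s1S|exact: s2S].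
  have avgs' : average s = a *: average s1 + (1 - a) *: average s2 -
      (a - a') *: (average s1 - average s2).
    rewrite avgs scalerBr opprB [X in _ = _ + X]addrC [RHS]addrACA -scalerBl -scalerDl.
    by congr (_ *: _ + _ *: _); ring.
  have -> : a *: w1 + (1 - a) *: w2 - average s =
      a *: (w1 - average s1) + (1 - a) *: (w2 - average s2) +
      (a - a') *: (average s1 - average s2).
    rewrite avgs' opprB (scalerBr a w1) (scalerBr (1 - a) w2).
    by rewrite [in RHS](addrACA (a *: w1)) -opprD -[RHS]addrA [in RHS](addrC (- _)).
  rewrite (splitr e) (le_lt_trans (ler_normD _ _))// ltr_leD//.
    rewrite (le_lt_trans (ler_normD _ _))// !normrZ ger0_norm// ger0_norm ?subr_ge0//.
    apply: (@lt_le_trans _ _ (a * (e / 2) + (1 - a) * (e / 2))); last first.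
      by rewrite -mulrDl subrKC mul1r.
    have [->|an0] := eqVneq a 0; first by rewrite !mul0r !add0r subr0 !mul1r.
    by rewrite ltr_leD// ?ltr_pM2l ?lt0r ?an0// ler_wpM2l ?subr_ge0// ltW.
  rewrite normrZ; apply: le_trans (ltW BM); rewrite mulrC.
  by apply: ler_pM => //; exact: ler_normB.
move=> vS e e0.
suff /(_ e e0) : P v by [].
apply: vS; split; first by split.
move=> y Sy d d0; exists [:: y]; split=> // [z|].
  by rewrite inE => /eqP ->.
by rewrite /average big_seq1 invr1 scale1r subrr normr0.
Qed.

End averages.

Section approximate_selection.
Context {R : realType} {X : normedModType R} {n : nat} (D : set R).
Context (b : 'I_n -> X) (c : 'I_n -> X -> R) (C : R).
Hypothesis bc : bounded_coordinates b c C.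
Hypothesis mD : measurable D.
Notation mu := (@lebesgue_measure R).
Notation lebesgue_set := (((@wlength R idfun)^*)%mu.-cara.-measurable).

Lemma measurable_fun_norm_sub (x0 : X) (g : R -> X) : vmeasurable c D g ->
  measurable_fun D (fun t => `|x0 - g t|).
Proof.
move=> mg; apply: (measurability (@RGenInftyO.G R)) => [|/= _ [_] [a] -> <-].
  exact: RGenInftyO.measurableE.
rewrite (_ : _ `&` _ = D `&` g @^-1` (ball x0 a)).
  by apply: (vmeasurable_open bc mD mg); exact: ball_open.
by apply/seteqP; split=> t [Dt]; rewrite /= in_itv/= -ball_normE.
Qed.

Context (G : R -> set X).
Hypothesis mG : forall O : set X, open O ->
  lebesgue_set [set t | D t /\ G t `&` O !=set0].

(** The radius depends on t; a rational strictly between |x0 - y| and eps t reduces the question to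
    countably many balls of fixed radius. *)
Lemma lebesgue_set_hit (x0 : X) (eps : R -> R) : measurable_fun D eps ->
  lebesgue_set [set t | D t /\ exists2 y, G t y & `|x0 - y| < eps t].
Proof.
move=> meps.
rewrite (_ : [set t | _] = \bigcup_(q in [set: rat])
  ((D `&` eps @^-1` `]ratr q, +oo[%classic) `&`
   [set t | D t /\ G t `&` ball x0 (ratr q : R) !=set0])).
  apply: (bigcupT_measurable_rat (fun q => _)) => q.
  apply: measurableI; last by apply: mG; exact: ball_open.
  by apply: measurable_lebesgue_set; apply: meps => //; exact: measurable_itv.
apply/seteqP; split=> t.
  move=> [Dt [y Gy yeps]].
  have [q] := rat_in_itvoo yeps; rewrite in_itv/= => /andP[yq qeps].
  exists q => //; split; first by split=> //=; rewrite in_itv/= qeps.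
  by split=> //; exists y; split=> //; rewrite -ball_normE.
move=> [q _ [[Dt]]]; rewrite /= in_itv/= andbT => qeps [_ [y [Gy]]].
by rewrite -ball_normE/= => yq; split=> //; exists y => //; exact: lt_trans qeps.
Qed.

Lemma lebesgue_set_lt (f h : R -> R) : measurable_fun D f -> measurable_fun D h ->
  lebesgue_set (D `&` [set t | (f t < h t)%R]).
Proof.
move=> mf mh; apply: measurable_lebesgue_set.
by apply: (measurable_fun_ltr mf mh mD (Y := [set true])).
Qed.

Context (d : nat -> X).
Hypothesis dd : forall x (e : R), 0 < e -> exists j, `|x - d j| < e.

Lemma vmeasurable_key (iota : R -> nat) (w : nat -> X) :
  (forall j, measurable (iota @^-1` [set j])) -> vmeasurable c D (fun t => w (iota t)).
Proof.
move=> miota i; apply: (measurable_fun_countable_key (fun j => c i (w j))) => j.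
exact: measurableI.
Qed.

(** A point y of [G t] within [del t] of [g t] is approximated within [eps t] by a term of the dense
    sequence, which is then within del t + eps t of [g t]. Both properties of an index define
    measurable sets of times; no measurable choice of y itself is made. *)
Lemma approximate_selection (g : R -> X) (del eps : R -> R) :
  vmeasurable c D g -> measurable_fun D del -> measurable_fun D eps ->
  (forall t, D t -> 0 < eps t) ->
  {ae mu, forall t, D t -> exists2 y, G t y & `|g t - y| < del t} ->
  exists g' : R -> X, vmeasurable c D g' /\
    {ae mu, forall t, D t -> `|g' t - g t| < del t + eps t /\
      exists2 y, G t y & `|g' t - y| < eps t}.
Proof.
move=> mg mdel meps eps0 hg.
pose S j := (D `&` [set t | (`|d j - g t| < del t + eps t)%R]) `&`
  [set t | D t /\ exists2 y, G t y & `|d j - y| < eps t].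
have [||iota [miota hiota]] := @countable_selection R D S.
- move=> j; apply: measurableI; last exact: lebesgue_set_hit.
  by apply: lebesgue_set_lt; [exact: measurable_fun_norm_sub|exact: measurable_funD].
- apply: filterS hg => t hgt Dt; have [y Gy ygt] := hgt Dt.
  have [j yj] := dd y (eps0 _ Dt).
  exists j; split; split=> //=; last by exists y; rewrite // distrC.
  rewrite (le_lt_trans (ler_distD y _ _))// addrC ltrD//; first by rewrite distrC.
  by rewrite distrC.
exists (fun t => d (iota t)); split; first exact: vmeasurable_key.
by apply: filterS hiota => t hit /hit[[_ ?] [_ ?]].
Qed.

(** An index encodes a finite list of terms of the dense sequence, so the lists take countably many
    values, as chattering requires. Half of [tau] is spent on approximating [v t] by an average of
    points of [G t], half on moving these points into the dense sequence. *)
Lemma average_selection (v : R -> X) (tau : R -> R) :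
  vmeasurable c D v -> measurable_fun D tau -> (forall t, D t -> 0 < tau t) ->
  {ae mu, forall t, D t -> clco (G t) (v t)} ->
  exists (iota : R -> nat) (q : nat -> nat -> X) (N : nat -> nat),
    (forall j, measurable (iota @^-1` [set j])) /\
    {ae mu, forall t, D t ->
      (forall i, (i <= N (iota t))%N -> exists2 y, G t y & `|q (iota t) i - y| < tau t) /\
      `|(N (iota t)).+1%:R^-1 *: (\sum_(i < (N (iota t)).+1) q (iota t) i) - v t|
        < tau t}.
Proof.
move=> mv mtau tau0 hv.
(* [N j] is the length of the list minus one, so averages have [(N j).+1] terms. The empty list,
   also the value of an index that encodes nothing, counts as the single entry [d 0]. *)
pose code j : seq nat := odflt [::] (unpickle j).
pose q j i := d (nth 0%N (code j) i).
pose N j := (size (code j)).-1.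
pose w j := (N j).+1%:R^-1 *: (\sum_(i < (N j).+1) q j i).
pose S j := (D `&` [set t | (`|w j - v t| < tau t)%R]) `&`
  \bigcap_(i in `I_(N j).+1) [set t | D t /\ exists2 y, G t y & `|q j i - y| < tau t].
have [||iota [miota hiota]] := @countable_selection R D S.
- move=> j; apply: measurableI; last first.
    by apply: bigcap_measurable => [|i _]; [exists 0%N|exact: lebesgue_set_hit].
  by apply: lebesgue_set_lt => //; exact: measurable_fun_norm_sub.
- apply: filterS hv => t hvt Dt.
  have t2 : 0 < tau t / 2 by rewrite divr_gt0// tau0.
  have [s [s0 sG sv]] := clco_average (hvt Dt) t2.
  have /choice[f hf] := fun y => dd y t2.
  exists (pickle (map f s)).
  have cE : code (pickle (map f s)) = map f s by rewrite /code pickleK.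
  have NE : (N (pickle (map f s))).+1 = size s.
    by rewrite /N cE size_map prednK// lt0n size_eq0.
  have qE i : (i < size s)%N -> q (pickle (map f s)) i = d (f (nth 0 s i)).
    by move=> si; rewrite /q cE (nth_map 0).
  split; [split=> //=|].
    rewrite distrC (splitr (tau t)) (le_lt_trans (ler_distD (average s) _ _))//.
    rewrite ltr_leD// /w NE /average -scalerBr normrZ ger0_norm ?invr_ge0//.
    rewrite mulrC ler_pdivrMr ?ltr0n ?lt0n ?size_eq0// (big_nth 0) big_mkord -sumrB.
    apply: (le_trans (ler_norm_sum _ _ _)).
    apply: (@le_trans _ _ (\sum_(i < size s) tau t / 2)).
      by apply: ler_sum => i _; rewrite qE// ltW.
    by rewrite sumr_const card_ord mulr_natr.
  rewrite NE => i /= si; split=> //; exists (nth 0 s i); first by apply: sG; exact: mem_nth.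
  rewrite qE// distrC (lt_trans (hf _))// ltr_pdivrMr ?ltr_pMr ?tau0//.
  by rewrite ltr1n.
exists iota, q, N; split=> //.
by apply: filterS hiota => t hit /hit[[_ ?] h]; split=> // i iN; have [] := h i iN.
Qed.

End approximate_selection.

(** * Successive approximations *)

Lemma geometric_cvg (R : realType) (X : completeNormedModType R) (u : nat -> X) (B : R) :
  0 <= B -> (forall m, `|u m.+1 - u m| <= B * 2^-1 ^+ m) ->
  exists l, (u m @[m --> \oo] --> l) /\ forall m, `|l - u m| <= 2 * B * 2^-1 ^+ m.
Proof.
move=> B0 uB.
have half0 m : 0 < 2^-1 ^+ m :> R by rewrite exprn_gt0// invr_gt0.
have uj m j : `|u (m + j)%N - u m| <= B * 2^-1 ^+ m * (2 - 2 * 2^-1 ^+ j).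
  elim: j => [|j IH]; first by rewrite addn0 subrr normr0 expr0 mulr1 subrr mulr0.
  rewrite addnS (le_trans (ler_distD (u (m + j)%N) _ _))//.
  apply: (le_trans (lerD (uB _) IH)).
  rewrite exprS exprD le_eqVlt; apply/orP; left; apply/eqP.
  move: (2^-1 ^+ m) (2^-1 ^+ j) => x y; rewrite [2 * (_ * _)]mulrA mulfV// mul1r.
  by ring.
have uj2 m j : (m <= j)%N -> `|u j - u m| <= 2 * B * 2^-1 ^+ m.
  move=> mj; rewrite -(subnKC mj) (le_trans (uj _ _))//.
  rewrite mulrBr lerBlDr mulrAC [B * 2]mulrC lerDl.
  by rewrite !mulr_ge0// ltW.
have cvgh : 2 * B * 2^-1 ^+ m @[m --> \oo] --> (0 : R).
  rewrite -[X in _ --> X](mulr0 (2 * B)); apply: cvgM; first exact: cvg_cst.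
  by apply: cvg_expr; rewrite ger0_norm ?invr_ge0// invf_lt1// ltr1n.
have /cauchy_cvgP/cvg_ex[l ul] : cauchy (u m @[m --> \oo]).
  apply: cauchy_exP => e e0.
  have [m _ hm] : \forall m \near \oo, 2 * B * 2^-1 ^+ m < e.
    exact: (cvgr_lt _ cvgh).
  have {}hm : 2 * B * 2^-1 ^+ m < e := hm m (leqnn m).
  exists (u m); exists m => // j /= mj; rewrite -ball_normE/= distrC.
  exact: le_lt_trans (uj2 _ _ mj) hm.
exists l; split=> // m.
have : `|u j - u m| @[j --> \oo] --> `|l - u m|.
  by apply: cvg_norm; apply: cvgB => //; exact: cvg_cst.
move=> /cvgr_to_le; apply; near=> j; apply: uj2.
by near: j; exact: nbhs_infty_ge.
Unshelve. all: by end_near. Qed.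

Section vector_limit.
Context {R : realType} {X : completeNormedModType R} {n : nat} (D : set R).
Context (b : 'I_n -> X) (c : 'I_n -> X -> R) (C : R).
Hypothesis bc : bounded_coordinates b c C.
Notation mu := (@lebesgue_measure R).

(** Off one Borel null set all increments are bounded at once; multiplying by the indicator of its
    complement makes the sequence converge at every point of [D], so that the limit is
    measurable. *)
Lemma vmeasurable_geometric_limit (g : nat -> R -> X) (W : R -> R) :
  (forall m, vmeasurable c D (g m)) -> (forall t, D t -> 0 <= W t) ->
  (forall m, {ae mu, forall t, D t ->
     `|g m.+1 t - g m t| <= W t * 2^-1 ^+ m}) ->
  exists gl : R -> X, vmeasurable c D gl /\
    {ae mu, forall t, D t -> forall m, `|gl t - g m t| <= 2 * W t * 2^-1 ^+ m}.
Proof.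
move=> mg W0 /ae_foralln[A [mA A0 hA]].
pose h m t := \1_(~` A) t *: g m t.
have hh m t : D t -> `|h m.+1 t - h m t| <= W t * 2^-1 ^+ m.
  move=> Dt; rewrite /h indicE; have [At|nAt] := pselect (A t).
    rewrite memNset ?scale0r ?subrr ?normr0; last by apply.
    by rewrite mulr_ge0 ?W0// exprn_ge0// invr_ge0.
  rewrite mem_set// !scale1r; apply: contrapT => nle; apply: nAt; apply: hA => /= hm.
  exact/nle/hm.
have /choice[gl hgl] : forall t, exists l, D t ->
    (h m t @[m --> \oo] --> l) /\ forall m, `|l - h m t| <= 2 * W t * 2^-1 ^+ m.
  move=> t; have [Dt|nDt] := pselect (D t); last by exists 0.
  by have [l hl] := geometric_cvg (W0 _ Dt) (fun m => hh m t Dt); exists l.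
exists gl; split=> [i|].
  apply: (@measurable_fun_cvg _ _ _ _ (fun m t => c i (h m t))) => [m|t Dt].
    rewrite (_ : (fun t => _) = \1_(~` A) \* (c i \o g m)); last first.
      by apply/funext => t; rewrite /h (coordZ bc).
    apply: measurable_funM => //; last exact: mg.
    apply: (measurable_funS (E := setT)) => //; apply: measurable_indic.
    exact: measurableC.
  have [hc _] := hgl t Dt.
  by apply: (cvg_comp _ _ hc); exact: (coord_continuous_fun bc).
exists A; split=> // t /= nh; apply: contrapT => nAt; apply: nh => Dt m.
have [_ /(_ m)] := hgl t Dt.
by rewrite /h indicE mem_set// scale1r.
Qed.

End vector_limit.

(** * Relaxation for Borel data with a single rate *)

Section relaxation.
Context {R : realType} {X : completeNormedModType R} {n : nat}.
Context (T : \bar R) (T0 : (0 < T)%E).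
Context (b : 'I_n -> X) (c : 'I_n -> X -> R) (C : R).
Hypothesis bc : bounded_coordinates b c C.
Notation mu := (@lebesgue_measure R).
Notation lebesgue_set := (((@wlength R idfun)^*)%mu.-cara.-measurable).
Local Notation D := (horizon T).
Context (F : R -> X -> set X) (z v : R -> X) (k rho : R -> R).
Hypothesis Fcl : forall t x, D t -> closed (F t x).
Hypothesis mF : forall x : R -> X, abs_continuous D x -> forall O : set X, open O ->
  lebesgue_set [set t | D t /\ F t (x t) `&` O !=set0].
Hypothesis zac : abs_continuous D z.
Hypothesis zv : {ae mu, forall t, D t ->
  h^-1 *: (z (h + t) - z t) @[h --> 0^'] --> v t}.
Hypothesis mv : vmeasurable c D v.
Hypothesis mk : measurable_fun D k.
Hypothesis k1 : forall t, D t -> 1 <= k t.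
Hypothesis ik : forall s, D s -> mu.-integrable `[0, s] (EFin \o k).
Hypothesis Flip : {ae mu, forall t, D t -> forall x y,
  `|z t - x| <= 1 -> `|z t - y| <= 1 -> forall w, F t x w -> forall e, 0 < e ->
  exists2 w', F t y w' & `|w - w'| < k t * `|x - y| + e}.
Hypothesis Fbnd : {ae mu, forall t, D t -> forall w, F t (z t) w -> `|w| <= k t}.
Hypothesis vF : {ae mu, forall t, D t -> clco (F t (z t)) (v t)}.
Hypothesis rho0 : forall t, D t -> 0 < rho t.
Hypothesis rho1 : forall t, D t -> rho t <= 1.
Hypothesis rhod : {in D &, {homo rho : s t / s <= t >-> t <= s}}.

Let mD : measurable D := measurable_horizon T.
Let K := coord_norm b C.
Let K0 : 0 < K := coord_norm_gt0 bc.

Lemma horizon0 : D 0.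
Proof. by split. Qed.

Lemma vintegral_cst0 (A : set R) : vintegral b c A (fun=> 0) = 0.
Proof.
apply: big1 => i _; rewrite (_ : (fun _ => _) = cst 0); last first.
  by apply/funext => t; rewrite (coord0 bc).
by rewrite /Rintegral integral0 scale0r.
Qed.

Lemma ae_speed_le : {ae mu, forall t, D t -> `|v t| <= k t}.
Proof.
apply: filterS2 vF Fbnd => t vt Ft Dt; apply/ler_addgt0Pr => e e0.
have [s [s0 sF sv]] := clco_average (vt Dt) e0.
rewrite -[v t](subrK (average s)) (le_trans (ler_normD _ _))// addrC lerD ?(ltW sv)//.
rewrite normrZ ger0_norm ?invr_ge0// mulrC ler_pdivrMr ?ltr0n ?lt0n ?size_eq0//.
apply: (le_trans (ler_norm_sum _ _ _)); rewrite (big_nth 0) big_mkord.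
apply: (@le_trans _ _ (\sum_(i < size s) k t)).
  by apply: ler_sum => i _; apply: Ft => //; apply: sF; exact: mem_nth.
by rewrite sumr_const card_ord mulr_natr.
Qed.

Section weighted_arcs.
Context (p : R -> R).
Hypothesis p0 : forall t, D t -> 0 < p t.
Hypothesis prho : forall t, D t -> p t <= rho t.
Hypothesis pd : {in D &, {homo p : s t / s <= t >-> t <= s}}.
Hypothesis ptail : forall t, D t ->
  (\int[mu]_(s in D `&` `[t, +oo[) (k s * p s)%:E <= ((6 * K)^-1 * p t)%:E)%E.

Local Notation W := (fun t => k t * p t).

Let p1 t : D t -> p t <= 1.
Proof. by move=> Dt; apply: le_trans (prho Dt) (rho1 Dt). Qed.

Let k0 t : D t -> 0 <= k t.
Proof. by move=> Dt; rewrite (le_trans ler01)// k1. Qed.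

Let W0 t : D t -> 0 < W t.
Proof. by move=> Dt; rewrite mulr_gt0 ?p0// (lt_le_trans ltr01)// k1. Qed.

Let Wk t : D t -> W t <= k t.
Proof. by move=> Dt; rewrite ler_piMr ?p1 ?k0. Qed.

Let mp : measurable_fun D p.
Proof. exact: nonincreasing_on_measurable (@horizon_interval _ T) pd. Qed.

Let mW : measurable_fun D W.
Proof. exact: measurable_funM. Qed.

Lemma integrable_weighted : mu.-integrable D (EFin \o W).
Proof.
apply: (@ge0_integrable_le _ _ _ _ _ _ ((6 * K)^-1 * p 0)) => // [t Dt|].
  exact/ltW/W0.
have := ptail horizon0; rewrite (_ : D `&` _ = D); first exact.
by apply/setIidPl => t [t0 _]; rewrite /= in_itv/= t0.
Qed.

Lemma integrable_weighted_scale (a : R) (S : set R) : measurable S -> S `<=` D ->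
  mu.-integrable S (EFin \o (fun t => a * W t)).
Proof.
move=> mS SD.
have iW : mu.-integrable S (EFin \o W) by apply: integrableS integrable_weighted.
have : mu.-integrable S (fun t => a%:E * (W t)%:E)%E by exact: integrableZl.
by [].
Qed.

Local Notation tail t := (D `&` `]t, +oo[%classic).

Let mtail t : measurable (tail t).
Proof. exact: measurableI. Qed.

Let tailD t : tail t `<=` D.
Proof. by move=> s []. Qed.

(** In the factor (6 K)^-1 of [ptail], K cancels the loss of coordinatewise integration, and 6
    leaves the ratio 1 / 6 between velocity and displacement on which the constants of
    [quasi_solution] rely. *)
Lemma Rintegral_tail_le (a t : R) : 0 <= a -> D t ->
  K * \int[mu]_(s in tail t) (a * W s) <= a / 6 * p t.
Proof.
move=> a0 Dt.
have iWt : mu.-integrable (tail t) (EFin \o W).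
  by apply: integrableS integrable_weighted; [exact: mD|exact: mtail|exact: tailD].
rewrite RintegralZl//; last exact: mtail.
have tW : \int[mu]_(s in tail t) W s <= (6 * K)^-1 * p t.
  rewrite -lee_fin /Rintegral fineK; last first.
    by apply: integrable_fin_num => //; exact: mtail.
  apply: le_trans (ptail Dt); apply: ge0_subset_integral.
  - exact: mtail.
  - by apply: measurableI => //; exact: measurable_itv.
  - by apply/measurable_EFinP; apply: measurable_funS mW => // s [].
  - by move=> s [Ds _]; rewrite lee_fin; exact/ltW/W0.
  - move=> s [Ds st]; split=> //; move: st; rewrite /= !in_itv/= !andbT.
    exact: ltW.
rewrite mulrCA -mulrA ler_wpM2l// (le_trans (ler_wpM2l (ltW K0) tW))//.
by rewrite invfM mulrA mulrCA mulfV ?mulr1// gt_eqF.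
Qed.

Lemma vintegral_tail_le (u : R -> X) (a t : R) : 0 <= a -> D t ->
  vmeasurable c D u -> {ae mu, forall s, D s -> `|u s| <= a * W s} ->
  `|vintegral b c (tail t) u| <= a / 6 * p t.
Proof.
move=> a0 Dt mu_ ua; apply: le_trans (Rintegral_tail_le a0 Dt).
apply: (le_norm_vintegral bc) => //.
- by apply: (vmeasurableS (A := D)).
- exact: integrable_weighted_scale.
- by move=> s /tailD Ds; rewrite mulr_ge0// ltW// W0.
- by apply: filterS ua => s us /tailD.
Qed.

Lemma vintegrable_weighted (u : R -> X) (a : R) (S : set R) : 0 <= a ->
  measurable S -> S `<=` D -> vmeasurable c D u ->
  {ae mu, forall s, D s -> `|u s| <= a * W s} -> vintegrable c S u.
Proof.
move=> a0 mS SD mu_ ua.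
apply: (vintegrable_dom bc mS _ (integrable_weighted_scale a mS SD)).
- by apply: (vmeasurableS (A := D)).
- by move=> s /SD Ds; rewrite mulr_ge0// ltW// W0.
- by apply: filterS ua => s us /SD.
Qed.

Let itvD t : D t -> `[0, t]%classic `<=` D.
Proof. exact: horizon_itvcc. Qed.

Lemma vintegrable_local (u : R -> X) (a : R) (s : R) : 0 <= a -> D s ->
  vmeasurable c D u -> {ae mu, forall t, D t -> `|u t| <= a * k t} ->
  vintegrable c `[0, s] u.
Proof.
move=> a0 Ds mu_ ua; have sub := itvD Ds.
have ia : mu.-integrable `[0, s] (EFin \o (fun t => a * k t)).
  have : mu.-integrable `[0, s] (fun t => a%:E * (k t)%:E)%E.
    by apply: integrableZl => //; exact: ik.
  by [].
apply: (vintegrable_dom bc _ _ ia) => //.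
- by apply: (vmeasurableS (A := D)).
- by move=> t /sub Dt; rewrite mulr_ge0// k0.
- by apply: filterS ua => t ut /sub.
Qed.

Lemma vintegral_head (u : R -> X) (t : R) : D t -> vintegrable c D u ->
  vintegral b c `[0, t] u - vintegral b c D u = - vintegral b c (tail t) u.
Proof.
move=> Dt iu.
have DE : D = `[0, t] `|` tail t.
  apply/seteqP; split=> s; last by case=> [/(itvD Dt)|[]].
  move=> Ds; have [ts|st] := ltP t s.
    by right; split=> //=; rewrite in_itv/= ts.
  by left; rewrite /= in_itv/= st; case: Ds => ->.
rewrite [in X in _ - X]DE vintegral_setU//.
- by rewrite opprD addrA subrr add0r.
- by rewrite -DE.
- apply/disj_set2P/seteqP; split=> // s [/= + [_ /=]].
  by rewrite !in_itv/= andbT => /andP[_]; rewrite leNgt => /negP.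
Qed.

Lemma add_primitive (x w u : R -> X) (a : X) : abs_continuous D x ->
  {ae mu, forall t, D t -> h^-1 *: (x (h + t) - x t) @[h --> 0^'] --> w t} ->
  (forall s, D s -> vintegrable c `[0, s] u) ->
  let y t := x t + vintegral b c `[0, t] u + a in
  abs_continuous D y /\
  {ae mu, forall t, D t -> h^-1 *: (y (h + t) - y t) @[h --> 0^'] --> w t + u t}.
Proof.
move=> xac xw iu y; split.
  apply: abs_continuousD; last exact: abs_continuous_cst.
  by apply: abs_continuousD => //; exact: vprimitive_abs_continuous.
apply: filterS2 xw (vprimitive_ae_derivative bc T0 iu) => t xt ut Dt.
rewrite (_ : (fun h => _) = fun h => h^-1 *: (x (h + t) - x t) +
  h^-1 *: (vintegral b c `[0, h + t] u - vintegral b c `[0, t] u)).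
  by apply: cvgD; [exact: xt|exact: ut].
apply/funext => h; rewrite -scalerDr; congr (_ *: _).
by rewrite /y opprD addrACA subrr addr0 opprD addrACA.
Qed.

(** With w the averages, g the chattering velocity, e = v - w and u = g - v, one has u = (g - w) -
    e. The integral of g - w over [0, t] is at most p(t) / 4 by chattering. The added constant, the
    integral of e over the whole horizon, turns minus the integral of e over [0, t] into that over
    the tail, at most p(t) / 12 since |e| <= k p / 2. The sum is below p(t) / 2. *)
Lemma base_arc : exists x0 g0 : R -> X,
  [/\ abs_continuous D x0, vmeasurable c D g0,
      {ae mu, forall t, D t -> h^-1 *: (x0 (h + t) - x0 t) @[h --> 0^'] --> g0 t},
      forall t, D t -> `|z t - x0 t| <= 2^-1 * p t &
      {ae mu, forall t, D t -> exists2 y, F t (z t) y & `|g0 t - y| < 2^-1 * W t}].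
Proof.
have [d dd] := dense_sequence bc.
pose tau t := 2^-1 * W t.
have mtau : measurable_fun D tau by exact: measurable_funM.
have tau0 t : D t -> 0 < tau t by move=> Dt; rewrite mulr_gt0 ?invr_gt0// W0.
have [iota [q [N [miota hq]]]] := average_selection bc mD (mF zac) dd mv mtau tau0 vF.
have qk : {ae mu, forall t, D t ->
    forall i, (i <= N (iota t))%N -> `|q (iota t) i| <= 2 * k t}.
  apply: filterS2 hq Fbnd => t qt Ft Dt i iN.
  have [/(_ i iN)[y Fy qy] _] := qt Dt.
  rewrite -[q _ _](subrK y) (le_trans (ler_normD _ _))// mulrDl mul1r lerD//.
    apply: (le_trans (ltW qy)); apply: le_trans (Wk Dt).
    by rewrite /tau ler_piMl ?(ltW (W0 Dt))// invf_le1// ler1n.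
  exact: Ft.
have q4 : 0 < 4^-1 :> R by rewrite invr_gt0.
have [idx [idxN mg mw cg]] := chattering T0 bc mk k1 ik p0 p1 pd q4 miota qk.
set g := fun t => q (iota t) (idx t) in mg cg.
set w := fun t => _ *: _ in mw cg.
pose e t := v t - w t.
pose u t := g t - v t.
have me : vmeasurable c D e by exact: (vmeasurableB bc).
have mu_ : vmeasurable c D u by exact: (vmeasurableB bc).
have eW : {ae mu, forall t, D t -> `|e t| <= 2^-1 * W t}.
  by apply: filterS hq => t qt Dt; have [_ /ltW] := qt Dt; rewrite distrC.
have uk : {ae mu, forall t, D t -> `|u t| <= 3 * k t}.
  apply: filterS2 qk ae_speed_le => t qt vt Dt.
  rewrite (le_trans (ler_normB _ _))// (_ : 3 * k t = 2 * k t + k t).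
    by apply: lerD; [exact: qt|exact: vt].
  by rewrite -[X in _ = _ + X]mul1r -mulrDl natr1.
have iu s : D s -> vintegrable c `[0, s] u.
  by move=> Ds; apply: (@vintegrable_local u 3).
have half0 : 0 <= 2^-1 :> R by rewrite invr_ge0.
have ieD : vintegrable c D e by exact: (vintegrable_weighted half0).
have ie s : D s -> vintegrable c `[0, s] e.
  by move=> Ds; apply: vintegrableS ieD => //; exact: itvD.
have [x0ac x0d] := add_primitive (vintegral b c D e) zac zv iu.
exists (fun t => z t + vintegral b c `[0, t] u + vintegral b c D e), g; split=> //.
- by apply: filterS x0d => t h Dt; have := h Dt; rewrite /u [v t + _]addrC subrK.
- move=> t Dt.
  have gwE : vintegral b c `[0, t] u =
      vintegral b c `[0, t] (fun s => g s - w s) - vintegral b c `[0, t] e.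
    have igw : vintegrable c `[0, t] (fun s => g s - w s).
      rewrite (_ : (fun _ => _) = fun s => u s - (w s - v s)).
        apply: (vintegrableB bc) => //; first exact: iu.
        rewrite (_ : (fun _ => _) = fun s => 0 - e s).
          apply: (vintegrableB bc) => //; last exact: ie.
          move=> i; rewrite (_ : _ \o _ = cst 0%E); first exact: integrable0.
          by apply/funext => s /=; rewrite (coord0 bc).
        by apply/funext => s; rewrite sub0r opprB.
      by apply/funext => s; rewrite /u opprB addrA subrK.
    rewrite -(vintegralB bc)//; last exact: ie.
    by congr vintegral; apply/funext => s; rewrite /u/e opprB addrA subrK.
  have tE : - vintegral b c `[0, t] e + vintegral b c D e = vintegral b c (tail t) e.
    by rewrite -[RHS]opprK -(vintegral_head Dt ieD) opprB addrC.
  rewrite -addrA opprD addrA subrr sub0r normrN gwE -addrA tE.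
  rewrite (le_trans (ler_normD _ _))//.
  apply: (le_trans (lerD (cg t Dt) (vintegral_tail_le half0 Dt me eW))).
  rewrite -mulrDl ler_wpM2r ?(ltW (p0 Dt))//.
  lra.
- apply: filterS hq => t qt Dt; have [/(_ _ (idxN t))[y Fy gy] _] := qt Dt.
  by exists y.
Qed.

Context (x0 g0 : R -> X).
Hypothesis x0ac : abs_continuous D x0.
Hypothesis mg0 : vmeasurable c D g0.
Hypothesis zx0 : forall t, D t -> `|z t - x0 t| <= 2^-1 * p t.

(** For t in [D] this is x0 t minus the integral of g - g0 after t. Written as a primitive minus a
    constant, it has its absolute continuity and its derivative at once. *)
Definition arc (g : R -> X) (t : R) : X := x0 t +
  vintegral b c `[0, t] (fun s => g s - g0 s) - vintegral b c D (fun s => g s - g0 s).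

(** The constant 3 is the sum of all the velocity increments 3 * 2^-(m+1). *)
Definition dominated (g : R -> X) : Prop :=
  vmeasurable c D g /\ {ae mu, forall t, D t -> `|g t - g0 t| <= 3 * W t}.

Lemma dominated_vintegrable (g : R -> X) (S : set R) : dominated g ->
  measurable S -> S `<=` D -> vintegrable c S (fun s => g s - g0 s).
Proof.
move=> [mg gW] mS SD; apply: (@vintegrable_weighted _ 3) => //.
exact: (vmeasurableB bc).
Qed.

Lemma arcE (g : R -> X) (t : R) : dominated g -> D t ->
  arc g t = x0 t - vintegral b c (tail t) (fun s => g s - g0 s).
Proof.
move=> gd Dt; rewrite /arc -addrA (vintegral_head Dt)//.
exact: (dominated_vintegrable gd).
Qed.

Lemma arc_abs_continuous (g : R -> X) : dominated g -> abs_continuous D (arc g).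
Proof.
move=> gd; apply: abs_continuousD; last exact: abs_continuous_cst.
apply: abs_continuousD => //; apply: vprimitive_abs_continuous => s Ds.
by apply: (dominated_vintegrable gd) => //; exact: itvD.
Qed.

Lemma arcB (g h : R -> X) (a t : R) : 0 <= a -> dominated g -> dominated h ->
  {ae mu, forall s, D s -> `|g s - h s| <= a * W s} -> D t ->
  `|arc g t - arc h t| <= a / 6 * p t.
Proof.
move=> a0 gd hd gh Dt; rewrite !arcE// opprD addrACA subrr add0r opprK addrC.
rewrite -(vintegralB bc); [|exact: mtail|by apply: dominated_vintegrable => //; exact: mtail
  |by apply: dominated_vintegrable => //; exact: mtail].
have [mg _] := gd; have [mh _] := hd.
apply: vintegral_tail_le => //.
  by do 2 apply: (vmeasurableB bc) => //.
apply: filterS gh => s ghs Ds.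
by rewrite opprB addrA subrK distrC ghs.
Qed.

Local Notation alpha m := (2^-1 ^+ m.+1 : R).

Let alpha0 m : 0 < alpha m.
Proof. by rewrite exprn_gt0// invr_gt0. Qed.

Let alphaS m : alpha m.+1 = alpha m / 2.
Proof. by rewrite exprSr. Qed.

(** Three budgets, with alpha_m = 2^-(m+1): the velocity has used all but 6 alpha_m of a total 3,
    the arc all but alpha_m of a total 1, and the velocity is within 2 alpha_m of F along its own
    arc. At m = 0 the bounds are 0, 1 / 2 and 1, and a step reproduces them. *)
Definition quasi_solution (m : nat) (g : R -> X) : Prop :=
  [/\ vmeasurable c D g,
      {ae mu, forall t, D t -> `|g t - g0 t| <= (3 - 6 * alpha m) * W t},
      forall t, D t -> `|z t - arc g t| <= (1 - alpha m) * p t &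
      {ae mu, forall t, D t ->
        exists2 y, F t (arc g t) y & `|g t - y| < 2 * alpha m * W t}].

Lemma quasi_solution_dominated m g : quasi_solution m g -> dominated g.
Proof.
move=> [mg gW _ _]; split=> //; apply: filterS gW => t gt Dt.
apply: (le_trans (gt Dt)); rewrite ler_wpM2r ?(ltW (W0 Dt))// gerBl.
by rewrite mulr_ge0// ltW.
Qed.

Lemma quasi_solution_tube m g t : quasi_solution m g -> D t -> `|z t - arc g t| <= 1.
Proof.
move=> [_ _ + _] Dt => /(_ t Dt) /le_trans; apply.
by apply: le_trans (p1 Dt); rewrite ler_piMl ?(ltW (p0 Dt))// gerBl.
Qed.

Lemma near_velocity (x y g : R -> X) (a e : R) :
  (forall t, D t -> `|z t - x t| <= 1) -> (forall t, D t -> `|z t - y t| <= 1) ->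
  (forall t, D t -> `|x t - y t| <= a * p t) ->
  {ae mu, forall t, D t -> exists2 w, F t (x t) w & `|g t - w| < e * W t} ->
  {ae mu, forall t, D t -> exists2 w, F t (y t) w & `|g t - w| < (a + e) * W t}.
Proof.
move=> zx zy xy; apply: filterS2 Flip => t Ft gt Dt.
have [w Fw gw] := gt Dt.
(* The strict inequality at x leaves a slack, which pays for the excess in [Flip]. *)
have d0 : 0 < e * W t - `|g t - w| by rewrite subr_gt0.
have [w' Fw' ww'] := Ft Dt (x t) (y t) (zx t Dt) (zy t Dt) w Fw _ d0.
exists w' => //; rewrite (le_lt_trans (ler_distD w _ _))//.
have kxy : k t * `|x t - y t| <= a * W t.
  by rewrite mulrCA ler_wpM2l ?k0// xy.
rewrite mulrDl; apply: (@lt_le_trans _ _ (`|g t - w| +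
  (k t * `|x t - y t| + (e * W t - `|g t - w|)))); first by rewrite ltrD2l.
by move: kxy; lra.
Qed.

(** The new velocity is selected with excess alpha_{m+1}, so in units of k p it differs from the old
    one by at most (2 + 1 / 2) alpha_m <= 3 alpha_m; the arc moves by a sixth of the latter bound,
    alpha_{m+1} p. The distance of g' to F is alpha_{m+1} along the old arc, and the Lipschitz rate
    adds alpha_{m+1} along the new one. *)
Lemma quasi_solution_step m g : quasi_solution m g -> exists g' : R -> X,
  quasi_solution m.+1 g' /\
  {ae mu, forall t, D t -> `|g' t - g t| <= 3 * alpha m * W t}.
Proof.
move=> gm; have gd := quasi_solution_dominated gm; have [mg gW zg gF] := gm.
have [d dd] := dense_sequence bc.
have mWa a : measurable_fun D (fun t => a * W t) by exact: measurable_funM.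
have Wa a t : 0 < a -> D t -> 0 < a * W t by move=> a0 Dt; rewrite mulr_gt0// W0.
have [g' [mg' hg']] := approximate_selection bc mD (mF (arc_abs_continuous gd)) dd mg
  (mWa (2 * alpha m)) (mWa (alpha m.+1)) (fun t => Wa _ t (alpha0 m.+1)) gF.
have g'g : {ae mu, forall t, D t -> `|g' t - g t| <= 3 * alpha m * W t}.
  apply: filterS hg' => t h Dt; have [/ltW gt _] := h Dt.
  apply: (le_trans gt); rewrite -mulrDl ler_wpM2r ?(ltW (W0 Dt))// alphaS.
  by have := alpha0 m; lra.
have g'W : {ae mu, forall t, D t -> `|g' t - g0 t| <= (3 - 6 * alpha m.+1) * W t}.
  apply: filterS2 g'g gW => t h1 h2 Dt.
  rewrite (le_trans (ler_distD (g t) _ _))// (le_trans (lerD (h1 Dt) (h2 Dt)))//.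
  rewrite -mulrDl ler_wpM2r ?(ltW (W0 Dt))// alphaS.
  by have := alpha0 m; lra.
have g'd : dominated g'.
  split=> //; apply: filterS g'W => t gt Dt.
  apply: (le_trans (gt Dt)); rewrite ler_wpM2r ?(ltW (W0 Dt))// gerBl.
  by rewrite mulr_ge0// ltW.
have xx' t : D t -> `|arc g t - arc g' t| <= alpha m.+1 * p t.
  move=> Dt; rewrite distrC.
  have a3 : 0 <= 3 * alpha m by rewrite mulr_ge0// ltW.
  apply: (le_trans (arcB a3 g'd gd g'g Dt)).
  by rewrite ler_wpM2r ?(ltW (p0 Dt))// alphaS; have := alpha0 m; lra.
have zg' t : D t -> `|z t - arc g' t| <= (1 - alpha m.+1) * p t.
  move=> Dt; rewrite (le_trans (ler_distD (arc g t) _ _))//.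
  rewrite (le_trans (lerD (zg t Dt) (xx' t Dt)))// -mulrDl.
  by rewrite ler_wpM2r ?(ltW (p0 Dt))// alphaS; have := alpha0 m; lra.
exists g'; split=> //; split=> //.
have -> : 2 * alpha m.+1 = alpha m.+1 + alpha m.+1 by rewrite mulr_natl mulr2n.
apply: (near_velocity (x := arc g)) => //.
- by move=> t Dt; exact: quasi_solution_tube gm Dt.
- move=> t Dt; apply: (le_trans (zg' t Dt)); apply: le_trans (p1 Dt).
  by rewrite ler_piMl ?(ltW (p0 Dt))// gerBl ltW.
- by apply: filterS hg' => t h Dt; have [_] := h Dt.
Qed.

Lemma quasi_solution0 :
  {ae mu, forall t, D t -> exists2 y, F t (z t) y & `|g0 t - y| < 2^-1 * W t} ->
  quasi_solution 0 g0.
Proof.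
move=> g0F.
have arc0 t : arc g0 t = x0 t.
  rewrite /arc (_ : (fun s => _) = fun=> 0); last by apply/funext => s; rewrite subrr.
  by rewrite !vintegral_cst0 addr0 subr0.
split=> //.
- apply: filterE => t Dt; rewrite subrr normr0 mulr_ge0 ?(ltW (W0 Dt))//.
  by rewrite expr1; lra.
- move=> t Dt; rewrite arc0 (le_trans (zx0 Dt))// ler_wpM2r ?(ltW (p0 Dt))//.
  by rewrite expr1; lra.
(* One half is the distance to F along z, the other the price of replacing z by x0. *)
have -> : 2 * alpha 0 = 2^-1 + 2^-1 :> R by rewrite expr1 mulr_natl mulr2n.
apply: (near_velocity (x := z)) => //.
- by move=> t _; rewrite subrr normr0.
- move=> t Dt; rewrite arc0 (le_trans (zx0 Dt))// (le_trans _ (p1 Dt))//.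
  by rewrite ler_piMl ?(ltW (p0 Dt))//; lra.
- by move=> t Dt; rewrite arc0; exact: zx0.
Qed.

Lemma quasi_solution_limit :
  {ae mu, forall t, D t -> h^-1 *: (x0 (h + t) - x0 t) @[h --> 0^'] --> g0 t} ->
  {ae mu, forall t, D t -> exists2 y, F t (z t) y & `|g0 t - y| < 2^-1 * W t} ->
  exists x g : R -> X, [/\ abs_continuous D x,
    {ae mu, forall t, D t -> (h^-1 *: (x (h + t) - x t) @[h --> 0^'] --> g t) /\
      F t (x t) (g t)} &
    forall t, D t -> `|z t - x t| <= p t].
Proof.
move=> x0d g0F; have q0 := quasi_solution0 g0F.
(* Velocities are bundled with their index so that choice yields one map to iterate; [sm] records
   that the index after m iterations is m. *)
pose S := {mg : nat * (R -> X) | quasi_solution mg.1 mg.2}.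
have step (s : S) : exists s' : S, (sval s').1 = (sval s).1.+1 /\
    {ae mu, forall t, D t ->
      `|(sval s').2 t - (sval s).2 t| <= 3 * alpha (sval s).1 * W t}.
  case: s => [[m g] h]; have [g' [h' gg']] := quasi_solution_step h.
  by exists (exist _ (m.+1, g') h').
have /choice[f hf] := step.
pose s m : S := iter m f (exist _ (0%N, g0) q0).
have sm m : (sval (s m)).1 = m by elim: m => // m IH; have [-> _] := hf (s m); rewrite IH.
pose g m := (sval (s m)).2.
have gq m : quasi_solution m (g m) by have := svalP (s m); rewrite sm.
have gd m : dominated (g m) := quasi_solution_dominated (gq m).
have mg m : vmeasurable c D (g m) by have [] := gq m.
have gS m : {ae mu, forall t, D t ->
    `|g m.+1 t - g m t| <= (3 / 2 * W t) * 2^-1 ^+ m}.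
  have [_] := hf (s m); rewrite sm; apply: filterS => t h Dt.
  by apply: (le_trans (h Dt)); rewrite exprS; set y := _ ^+ m; lra.
have W32 t : D t -> 0 <= 3 / 2 * W t by move=> Dt; have := W0 Dt; lra.
have [gl [mgl hgl]] := vmeasurable_geometric_limit bc mg W32 gS.
have glm m : {ae mu, forall t, D t -> `|gl t - g m t| <= 6 * alpha m * W t}.
  apply: filterS hgl => t h Dt; apply: (le_trans (h Dt m)).
  by rewrite exprS; set y := _ ^+ m; lra.
have gld : dominated gl.
  split=> //; apply: filterS (glm 0%N) => t h Dt; apply: (le_trans (h Dt)).
  by rewrite expr1; lra.
have xm m t : D t -> `|arc (g m) t - arc gl t| <= alpha m * p t.
  move=> Dt; have a6 : 0 <= 6 * alpha m by rewrite mulr_ge0// ltW.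
  rewrite distrC; have := arcB a6 gld (gd m) (glm m) Dt.
  by rewrite [6 * _]mulrC mulfK.
have zx t : D t -> `|z t - arc gl t| <= p t.
  move=> Dt; rewrite (le_trans (ler_distD (arc (g 0%N) t) _ _))//.
  have [_ _ /(_ t Dt) zg _] := gq 0%N.
  apply: (le_trans (lerD zg (xm 0%N t Dt))).
  by rewrite -mulrDl expr1; have := p0 Dt; lra.
exists (arc gl), gl; split=> //; first exact: arc_abs_continuous.
have idl s' : D s' -> vintegrable c `[0, s'] (fun t => gl t - g0 t).
  by move=> Ds; apply: dominated_vintegrable => //; exact: itvD.
have [_ xd] := add_primitive (- vintegral b c D (fun t => gl t - g0 t)) x0ac x0d idl.
(* 9 = 6 + 1 + 2: the distance from [gl] to [g m], the passage from the arc of [g m] to the limit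
   arc, and the defect of [g m]. *)
have glF : {ae mu, forall t, D t -> forall m,
    exists2 w, F t (arc gl t) w & `|gl t - w| < 9 * alpha m * W t}.
  have /ae_foralln : forall m, {ae mu, forall t, D t ->
      exists2 w, F t (arc gl t) w & `|gl t - w| < 9 * alpha m * W t}.
    move=> m; have [_ _ _ gF] := gq m.
    have : {ae mu, forall t, D t -> exists2 w, F t (arc gl t) w &
        `|g m t - w| < (alpha m + 2 * alpha m) * W t}.
      apply: (near_velocity (x := arc (g m))) gF => //.
      - by move=> t Dt; exact: quasi_solution_tube (gq m) Dt.
      - by move=> t Dt; apply: le_trans (p1 Dt); exact: zx.
      - exact: xm.
    apply: filterS2 (glm m) => t h1 h2 Dt; have [w Fw gw] := h2 Dt.
    exists w => //; rewrite (le_lt_trans (ler_distD (g m t) _ _))//.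
    apply: (lt_le_trans (ler_ltD (h1 Dt) gw)).
    by have := W0 Dt; set y := alpha m; lra.
  by apply: filterS => t h Dt m; exact: h.
apply: filterS2 xd glF => t xt Ft Dt; split.
  by have := xt Dt; rewrite [g0 t + _]addrC subrK.
apply: (Fcl Dt) => B /nbhs_ballP[e /= e0 eB].
have cvgW : 9 * W t * 2^-1 ^+ m @[m --> \oo] --> (0 : R).
  rewrite -[X in _ --> X](mulr0 (9 * W t)); apply: cvgM; first exact: cvg_cst.
  by apply: cvg_expr; rewrite ger0_norm ?invr_ge0// invf_lt1// ltr1n.
have [m _ hm] : \forall m \near \oo, 9 * W t * 2^-1 ^+ m < e.
  exact: (cvgr_lt _ cvgW).
have [w Fw gw] := Ft Dt m.
exists w; split=> //; apply: eB; rewrite -ball_normE/=.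
apply: (lt_trans gw); have {}hm : 9 * W t * 2^-1 ^+ m.+1 < e := hm m.+1 (leqnSn m).
by rewrite mulrAC.
Qed.

End weighted_arcs.

Lemma relaxation_Borel : exists x g : R -> X, [/\ abs_continuous D x,
  {ae mu, forall t, D t -> (h^-1 *: (x (h + t) - x t) @[h --> 0^'] --> g t) /\
    F t (x t) (g t)} &
  forall t, D t -> `|z t - x t| <= rho t].
Proof.
have q0 : 0 < (6 * K)^-1 by rewrite invr_gt0 mulr_gt0.
have [p [p0 prho pd ptail]] := exists_weight T0 mk k1 ik q0 rho0 rhod.
have [x0 [g0 [x0ac mg0 x0d zx0 g0F]]] := base_arc p0 prho pd ptail.
have [x [g [xac xg zx]]] :=
  quasi_solution_limit p0 prho pd ptail x0ac mg0 zx0 x0d g0F.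
by exists x, g; split=> // t Dt; apply: (le_trans (zx t Dt)); exact: prho.
Qed.

End relaxation.

(** * Reduction to Borel data *)

Section arcs.
Context {R : realType} {X : normedModType R} (T : \bar R) (T0 : (0 < T)%E).
Notation mu := (@lebesgue_measure R).
Local Notation D := (horizon T).

Lemma abs_continuous_preimage (x : R -> X) (O : set X) : abs_continuous D x ->
  open O -> measurable (D `&` x @^-1` O).
Proof.
move=> xac oO; have [s [sD _ sT]] := horizon_exhaustion T0.
have -> : D `&` x @^-1` O = \bigcup_m (`[0, s m]%classic `&` x @^-1` O).
  rewrite -setI_bigcupl; congr (_ `&` _); apply/seteqP; split=> t.
    move=> Dt; have [m tm] := sT _ Dt; exists m => //=.
    by rewrite in_itv/= (ltW tm) andbT; case: Dt.
  by move=> [m _]; exact: horizon_itvcc.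
apply: bigcupT_measurable => m.
have /continuousP/(_ _ oO)/open_subspaceP[V oV VE] :=
  abs_continuous_itv_continuous (xac _ _ (horizon_itvcc (sD m))).
rewrite setIC -VE; apply: measurableI; first exact: open_measurable.
exact: measurable_itv.
Qed.

Lemma abs_continuous_bounded (x : R -> X) (s : R) : abs_continuous D x -> D s ->
  exists M, forall t, `[0, s]%classic t -> `|x t| <= M.
Proof.
move=> xac Ds; have [s0 _] := Ds.
have xc := abs_continuous_itv_continuous (xac _ _ (horizon_itvcc Ds)).
have nc : {within `[0, s], continuous (fun t => `|x t|)}.
  by move=> t; apply: continuous_comp; [exact: xc|exact: norm_continuous].
have [u _ um] := EVT_max s0 nc.
by exists `|x u| => t tI; exact: um.
Qed.

Lemma measurable_fun_norm (x : R -> X) : abs_continuous D x ->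
  measurable_fun D (fun t => `|x t|).
Proof.
move=> xac; apply: (measurability (@RGenInftyO.G R)) => [|/= _ [_] [a] -> <-].
  exact: RGenInftyO.measurableE.
rewrite (_ : _ `&` _ = D `&` x @^-1` (ball 0 a)).
  by apply: abs_continuous_preimage xac _; exact: ball_open.
by apply/seteqP; split=> t [Dt]; rewrite /= in_itv/= -ball_normE/= sub0r normrN.
Qed.

Context {n : nat} (b : 'I_n -> X) (c : 'I_n -> X -> R) (C : R).
Hypothesis bc : bounded_coordinates b c C.

Lemma abs_continuous_vmeasurable (x : R -> X) : abs_continuous D x -> vmeasurable c D x.
Proof.
move=> xac i; apply: (measurability (@RGenInftyO.G R)) => [|/= _ [_] [a] -> <-].
  exact: RGenInftyO.measurableE.
rewrite (_ : _ `&` _ = D `&` x @^-1` ((c i : X -> R^o) @^-1` `]-oo, a[%classic)).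
  apply: abs_continuous_preimage xac _; apply: open_comp; last exact: interval_open.
  by move=> y _; exact: (coord_continuous_fun bc).
by [].
Qed.

(** The coordinates of the derivative are limits of quotients with increments 1 / (m + 1). A point
    of [0, T) stays there under small positive increments, so extending the coordinates of z by 0
    outside does not affect the limit. The indicator removes a Borel null set containing the points
    of nondifferentiability. *)
Lemma velocity_vmeasurable (z : R -> X) : abs_continuous D z ->
  {ae mu, forall t, D t -> derivable z t 1} ->
  exists v : R -> X, vmeasurable c D v /\ {ae mu, forall t, D t -> v t = derive1 z t}.
Proof.
move=> zac [A [mA A0 hA]].
have mD := measurable_horizon T.
pose v t := \1_(~` A) t *: derive1 z t.
have vE t : ~ A t -> v t = derive1 z t.
  by move=> nAt; rewrite /v indicE mem_set// scale1r.
exists v; split; last first.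
  exists A; split=> // t /= nh; apply: contrapT => nAt; apply: nh => _.
  exact: vE.
move=> i; pose Z := (c i \o z) \_ D.
have mZ : measurable_fun setT Z.
  by apply/(measurable_restrictT _ mD); exact: abs_continuous_vmeasurable.
pose h m t := \1_(~` A) t * (m.+1%:R * (Z (m.+1%:R^-1 + t) - Z t)).
apply: (@measurable_fun_cvg _ _ _ _ h) => [m|t Dt].
  apply: (measurable_funS (E := setT)) => //.
  apply: measurable_funM; first by apply: measurable_indic; exact: measurableC.
  apply: measurable_funM => //; apply: measurable_funB => //.
  by apply: measurableT_comp => //; exact: measurable_funD.
rewrite /= /v (coordZ bc); have [At|nAt] := pselect (A t).
  rewrite (_ : h ^~ t = cst 0); last first.
    by apply/funext => m; rewrite /h indicE memNset ?mul0r//; apply.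
  by rewrite indicE memNset ?mul0r; [exact: cvg_cst|apply].
have dz : derivable z t 1 by apply: contrapT => nd; apply: nAt; apply: hA => /= /(_ Dt).
have [s [sD _ sT]] := horizon_exhaustion T0.
have [l tl] := sT _ Dt.
have := proj2 (derive1P z t (derive1 z t)) (conj dz erefl).
move=> /(cvg_comp _ _) /(_ (@coord_continuous_fun _ _ _ _ _ _ bc i (derive1 z t))).
move=> /cvgr_dnbhsP /(_ (@harmonic R)) hz.
have {}hz := hz (conj (fun m => lt0r_neq0 (harmonic_gt0 m)) cvg_harmonic).
rewrite indicE mem_set// mul1r; apply: cvg_trans hz; apply: near_eq_cvg.
near=> m.
have mt : harmonic m + t < s l.
  by rewrite -ltrBrDr; near: m; apply: (cvgr_lt _ cvg_harmonic); rewrite subr_gt0.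
have Dm : D (harmonic m + t).
  apply: horizon_le (ltW mt) (sD l); apply: addr_ge0.
    exact/ltW/harmonic_gt0.
  by case: Dt.
rewrite /h indicE mem_set// mul1r /Z !patchE !mem_set//=.
by rewrite (coordZ bc) (coordB bc) /harmonic/= invrK.
Unshelve. all: by end_near. Qed.

End arcs.

(** * Completed Lebesgue measure and Borel majorants *)

Section completed.
Context {R : realType}.
Notation mu := (@lebesgue_measure R).
Notation cmu := (@completed_lebesgue_measure R).
Notation lebesgue_set := (((@wlength R idfun)^*)%mu.-cara.-measurable).
Local Open Scope ereal_scope.

Lemma ae_completed (P : R -> Prop) : {ae mu, forall t, P t} -> {ae cmu, forall t, P t}.
Proof. by move=> [A [mA A0 hA]]; exists A; split=> //; exact: sub_caratheodory. Qed.

Lemma measurable_fun_completed (A : set R) (f : R -> \bar R) :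
  measurable A -> measurable_fun setT f ->
  measurable_fun (A : set (caratheodory_type ((@wlength R idfun)^*)%mu)) f.
Proof.
move=> mA mf _ B mB; apply: sub_caratheodory; apply: measurableI => //.
by rewrite -[X in measurable X]setTI; exact: mf.
Qed.

(** The identity is measurable from the Lebesgue to the Borel sigma-field and carries the completed
    measure to Lebesgue measure, so this is the change of variables for a push-forward. *)
Lemma ge0_integral_completed (A : set R) (f : R -> \bar R) : measurable A ->
  measurable_fun setT f -> (forall t, 0 <= f t) ->
  \int[mu]_(t in A) f t = \int[cmu]_(t in A) f t.
Proof.
move=> mA mf f0.
have mid : measurable_fun setT
    (id : caratheodory_type ((@wlength R idfun)^*)%mu -> measurableTypeR R).
  by move=> _ B mB; rewrite setTI preimage_id; exact: sub_caratheodory.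
have /= <- := @ge0_integral_pushforward _ _ _ _ _ _ mid cmu A f mA.
- by apply: eq_measure_integral => B mB _.
- exact: measurable_funS mf.
- by move=> t _.
Qed.

Local Close Scope ereal_scope.
Context (T : \bar R) (T0 : (0 < T)%E).
Local Notation D := (horizon T).

(* The Borel majorant is a step function within 1 of |kap|, obtained by selecting
   the integer part. *)
Lemma L1_loc_majorant (kap : R -> R) : L1_loc D kap ->
  exists beta : R -> R, [/\ measurable_fun D beta, forall t, 0 <= beta t,
    forall s, D s -> mu.-integrable `[0, s] (EFin \o beta) &
    {ae mu, forall t, D t -> `|kap t| <= beta t}].
Proof.
move=> ikap.
have ikaps s : D s -> cmu.-integrable `[0, s]%classic (EFin \o kap).
  by move=> Ds; apply: ikap; [exact: segment_compact|exact: horizon_itvcc].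
pose S i := D `&` [set t | (i%:R <= `|kap t| < i.+1%:R)%R].
have mS i : lebesgue_set (S i).
  have [s [sD _ sT]] := horizon_exhaustion T0.
  rewrite (_ : S i = \bigcup_m (`[0, s m]%classic `&`
      (fun t => `|kap t|) @^-1` `[i%:R, i.+1%:R[%classic)).
    apply: bigcupT_measurable => m.
    have /integrableP[/measurable_EFinP mkap _] := ikaps _ (sD m).
    have mI : lebesgue_set `[0, s m]%classic by apply: sub_caratheodory; exact: measurable_itv.
    have mn : measurable_fun (`[0, s m]%classic :
        set (caratheodory_type ((@wlength R idfun)^*)%mu)) (fun t => `|kap t|).
      by apply: measurableT_comp.
    by apply: mn => //; exact: measurable_itv.
  rewrite -setI_bigcupl; congr (_ `&` _).
  apply/seteqP; split=> t.
    move=> Dt; have [m tm] := sT _ Dt; exists m => //=.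
    by rewrite in_itv/= (ltW tm) andbT; case: Dt.
  by move=> [m _]; exact: horizon_itvcc.
have [||iota [miota hiota]] := @countable_selection R D S.
- exact: mS.
- apply: filterE => t Dt; exists (Num.truncn `|kap t|); split=> //=.
  exact: truncn_itv.
pose beta t : R := (iota t).+1%:R.
have mbeta : measurable_fun setT beta.
  apply: (measurable_fun_countable_key (fun j => j.+1%:R : R)) => j.
  by rewrite setTI; exact: miota.
exists beta; split.
- exact: (measurable_funS (E := setT)).
- by move=> t; rewrite ler0n.
- move=> s Ds; apply/integrableP; split.
    by apply/measurable_EFinP; exact: (measurable_funS (E := setT)).
  (* Finiteness is checked for the completed measure, where beta <= |kap| + 1 has an integrable
     right-hand side. *)
  rewrite ge0_integral_completed//; last first.
    by apply/measurable_EFinP; exact: measurableT_comp.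
  have mI : lebesgue_set `[0, s]%classic by apply: sub_caratheodory; exact: measurable_itv.
  have := ikaps _ Ds => /integrable_abse ik.
  have i1 : cmu.-integrable `[0, s]%classic (EFin \o cst 1%R).
    apply: integrable_cst_fin => //.
    rewrite [ltLHS](_ : _ = mu `[0, s]%classic)// lebesgue_measure_itv/=.
    by case: ifP; rewrite ltry.
  have /integrableP[mk1 fin1] := integrableD mI ik i1.
  apply: le_lt_trans fin1.
  apply: ae_ge0_le_integral; [exact: mI|by move=> t _; exact: abse_ge0| |
    by move=> t _; exact: abse_ge0| |].
  - apply: measurable_fun_completed => //; apply: measurableT_comp => //.
    exact/measurable_EFinP.
  - exact: measurableT_comp.
  - apply: ae_completed; apply: filterS hiota => t hit tI.
    have [_ /= /andP[h _]] := hit (horizon_itvcc Ds tI).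
    have bk : beta t <= `|kap t| + 1 by rewrite /beta -natr1 lerD2r.
    have b0 : 0 <= beta t by rewrite ler0n.
    by rewrite lee_fin (ger0_norm b0) ger0_norm// addr_ge0.
- apply: filterS hiota => t hit Dt; have [_ /= /andP[_ h]] := hit Dt.
  exact: ltW.
Qed.

End completed.

(** The infimum in [dist_set] need not be attained, hence the excess [e]. *)
Lemma hausdorff_dist_near (R : realType) (X : normedModType R) (A B : set X) (a e : R) :
  (hausdorff_dist A B <= a%:E)%E -> 0 < e ->
  forall w, A w -> exists2 w', B w' & `|w - w'| < a + e.
Proof.
rewrite /hausdorff_dist ge_max => /andP[Aa _] e0 w Aw.
have wa : (dist_set w B < (a + e)%:E)%E.
  apply: (@le_lt_trans _ _ a%:E); last by rewrite lte_fin ltrDl.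
  by apply: le_trans Aa; apply: ereal_sup_ubound; exists w.
have [_ [w' Bw' <-]] := ereal_inf_lt wa.
by rewrite lte_fin; exists w'.
Qed.

(** * A rate valid near z *)

Section rate.
Context {R : realType} {X : normedModType R} (T : \bar R) (T0 : (0 < T)%E).
Notation mu := (@lebesgue_measure R).
Local Notation D := (horizon T).

Lemma measurable_fun_glue (D' : set R) (key : R -> nat) (f : nat -> R -> R) :
  measurable D' -> (forall j, measurable (D' `&` key @^-1` [set j])) ->
  (forall j, measurable_fun D' (f j)) -> measurable_fun D' (fun t => f (key t) t).
Proof.
move=> mD mkey mf _ B mB.
rewrite (_ : _ `&` _ = \bigcup_j ((D' `&` key @^-1` [set j]) `&` (D' `&` f j @^-1` B))).
  by apply: bigcupT_measurable => j; apply: measurableI => //; exact: mf.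
apply/seteqP; split=> t.
  by move=> [Dt Bt]; exists (key t).
by move=> [j _ [[Dt /= <-] [_ Bt]]].
Qed.

(** The null set in the bound on F depends on the point, so the bound is taken at the fixed point 0
    and carried to z(t) by the Lipschitz property, whose null set is uniform: the norm is at most
    [gam] plus |z t| times [beta]. Hence the factor N + 2 in [f]; its summand 1 ensures k >= 1. With
    N = [n t] one has |z t| < N + 1, so points within distance 1 of z t lie in the ball of radius N
    + 2. *)
Lemma exists_rate (F : R -> X -> set X) (z : R -> X) :
  locally_lipschitz_map D F -> locally_bounded_map D F -> abs_continuous D z ->
  exists k : R -> R, [/\ measurable_fun D k, forall t, D t -> 1 <= k t,
    forall s, D s -> mu.-integrable `[0, s] (EFin \o k),
    {ae mu, forall t, D t -> forall x y,
      `|z t - x| <= 1 -> `|z t - y| <= 1 -> forall w, F t x w -> forall e, 0 < e ->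
      exists2 w', F t y w' & `|w - w'| < k t * `|x - y| + e} &
    {ae mu, forall t, D t -> forall w, F t (z t) w -> `|w| <= k t}].
Proof.
move=> lipF bndF zac.
have mD := measurable_horizon T.
have /choice[beta hbeta] : forall N : nat, exists beta : R -> R,
    [/\ measurable_fun D beta, forall t, 0 <= beta t,
    forall s, D s -> mu.-integrable `[0, s] (EFin \o beta) &
    {ae mu, forall t, D t -> forall x y, `|x| <= N.+2%:R -> `|y| <= N.+2%:R ->
      (hausdorff_dist (F t x) (F t y) <= (beta t * `|x - y|)%:E)%E}].
  move=> N; have [kap [ikap hkap]] := lipF N.+2%:R (ltr0Sn _ _).
  have [beta [mb b0 ib kb]] := L1_loc_majorant T0 ikap.
  exists beta; split=> //; apply: filterS2 hkap kb => t ht kt Dt x y xN yN.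
  have := ht Dt x y; rewrite /closed_ball_/= !sub0r !normrN => /(_ xN yN) /le_trans.
  apply; rewrite lee_fin ler_wpM2r//.
  by apply: le_trans (kt Dt); exact: ler_norm.
have [alpha [ialpha halpha]] := bndF 1 ltr01.
have [gam [mg g0 ig ag]] := L1_loc_majorant T0 ialpha.
have hgam : {ae mu, forall t, D t -> forall w, F t 0 w -> `|w| <= gam t}.
  have h0 : closed_ball_ Num.norm 0 1 (0 : X).
    by rewrite /closed_ball_/= subrr normr0.
  apply: filterS2 (halpha 0 h0) ag => t ht at_ Dt w Fw.
  apply: le_trans (at_ Dt); apply: le_trans (ler_norm _).
  rewrite -lee_fin; apply: le_trans (ht Dt).
  by apply: ereal_sup_ubound; exists w.
(* Only points near z t matter at time t, so the radius N + 2 may depend on t. *)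
pose f (N : nat) t := 1 + N.+2%:R * beta N t + gam t.
pose n t := Num.truncn `|z t|.
have f1 N t : 1 <= f N t.
  have [_ b0 _ _] := hbeta N.
  by rewrite /f -addrA lerDl addr_ge0// mulr_ge0.
have zn t : `|z t| < (n t).+1%:R by exact: Num.Theory.truncnS_gt.
have mn j : measurable (D `&` n @^-1` [set j]).
  rewrite (_ : n @^-1` [set j] = (fun t => `|z t|) @^-1` `[j%:R, j.+1%:R[%classic).
    by apply: measurable_fun_norm => //; exact: measurable_itv.
  apply/seteqP; split=> t; rewrite /= in_itv/= -truncn_eq//.
    by move=> /eqP.
  by move/eqP.
have mf N : measurable_fun D (f N).
  have [mb _ _ _] := hbeta N.
  apply: measurable_funD => //; apply: measurable_funD => //.
  exact: measurable_funM.
have hb : {ae mu, forall t, D t -> forall N, forall x y, `|x| <= N.+2%:R -> `|y| <= N.+2%:R ->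
      (hausdorff_dist (F t x) (F t y) <= (beta N t * `|x - y|)%:E)%E}.
  have /ae_foralln : forall N, {ae mu, forall t, D t -> forall x y,
      `|x| <= N.+2%:R -> `|y| <= N.+2%:R ->
      (hausdorff_dist (F t x) (F t y) <= (beta N t * `|x - y|)%:E)%E}.
    by move=> N; have [] := hbeta N.
  by apply: filterS => t h Dt N; exact: h.
exists (fun t => f (n t) t); split=> //.
- exact: measurable_fun_glue.
- move=> s Ds; have [M hM] := abs_continuous_bounded zac Ds.
  have sub := horizon_itvcc Ds.
  pose m := Num.truncn M.
  have iff N : mu.-integrable `[0, s] (EFin \o f N).
    have [_ _ ib _] := hbeta N.
    have i1 : mu.-integrable `[0, s] (EFin \o cst 1).
      apply: integrable_cst_fin => //.
      rewrite [ltLHS](_ : _ = mu `[0, s]%classic)// lebesgue_measure_itv/=.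
      by case: ifP; rewrite ltry.
    have i2 : mu.-integrable `[0, s] (fun t => N.+2%:R%:E * (beta N t)%:E)%E.
      by apply: integrableZl => //; exact: ib.
    by have := integrableD _ (integrableD _ i1 i2) (ig _ Ds); apply.
  (* As z is bounded on [0, s], only finitely many of the [f N] occur there, and their sum
     dominates. *)
  have iS : mu.-integrable `[0, s] (fun t => \sum_(N < m.+1) (f N t)%:E)%E.
    by apply: integrable_sum => // N _; exact: iff.
  apply: le_integrable iS => //.
    apply/measurable_EFinP; apply: (measurable_funS mD sub).
    exact: measurable_fun_glue.
  move=> t tI /=; rewrite sumEFin lee_fin.
  have f0 N : 0 <= f N t by rewrite (le_trans ler01).
  rewrite (ger0_norm (f0 _)) ger0_norm ?sumr_ge0//.
  have nm : (n t < m.+1)%N.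
    by rewrite ltnS; apply: le_truncn; exact: hM.
  by rewrite (bigD1 (Ordinal nm))//= lerDl sumr_ge0.
- apply: filterS hb => t h Dt x y zx zy w Fw e e0.
  have zb u : `|z t - u| <= 1 -> `|u| <= (n t).+2%:R.
    move=> zu; rewrite -[u](subKr (z t)) (le_trans (ler_normB _ _))//.
    by rewrite -natr1 lerD// ltW.
  have [w' Fw' ww'] := hausdorff_dist_near (h Dt (n t) x y (zb x zx) (zb y zy)) e0 Fw.
  exists w' => //; apply: (lt_le_trans ww'); rewrite lerD2r ler_wpM2r//.
  have [_ b0 _ _] := hbeta (n t).
  have bb : beta (n t) t <= (n t).+2%:R * beta (n t) t by rewrite ler_peMl// ler1n.
  by rewrite /f -addrA (le_trans bb)// addrCA lerDl addr_ge0.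
- apply: filterS2 hb hgam => t h1 h2 Dt w Fw; apply/ler_addgt0Pr => e e0.
  have [_ b0 _ _] := hbeta (n t).
  have z2 : `|z t| <= (n t).+2%:R.
    by rewrite (le_trans (ltW (zn t)))// ler_nat.
  have o2 : `|0 : X| <= (n t).+2%:R by rewrite normr0.
  have [w' Fw' ww'] := hausdorff_dist_near (h1 Dt (n t) (z t) 0 z2 o2) e0 Fw.
  rewrite subr0 in ww'.
  rewrite -[w](subrK w') (le_trans (ler_normD _ _))//.
  apply: (le_trans (lerD (ltW ww') (h2 Dt _ Fw'))).
  rewrite /f addrAC lerD2r lerD2r mulrC (le_trans (ler_wpM2r (b0 t) z2))//.
  by rewrite lerDr.
Qed.

End rate.

Theorem theorem1 (R : realType) (X : completeNormedModType R)
  (hX : finite_dimensional X) (T : \bar R) (hT : (0 < T)%E)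
  (F : R -> X -> set X)
  (hF : forall (t : R) (v : X), horizon T t -> F t v !=set0 /\ closed (F t v))
  (hmeas : setvalued_measurable (horizon T) F)
  (hlip : locally_lipschitz_map (horizon T) F)
  (hbnd : locally_bounded_map (horizon T) F)
  (xi : X) (z : R -> X)
  (hz : is_solution (horizon T) (fun t v => clco (F t v)) z)
  (hz0 : z 0 = xi)
  (r : R -> R) (hrc : {within horizon T, continuous r})
  (hr : forall t : R, horizon T t -> 0 < r t) :
  exists eta0 : X, closed_ball_ Num.norm xi (r 0) eta0 /\
    exists x : R -> X,
      [/\ is_solution (horizon T) F x, x 0 = eta0 &
          forall t : R, horizon T t -> `|z t - x t| <= r t].
Proof.
have [zac zd] := hz.
have [n [b [c [C bc]]]] := finite_dimensional_coordinates hX.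
have dz : {ae (@lebesgue_measure R), forall t, horizon T t -> derivable z t 1}.
  by apply: filterS zd => t h Dt; have [] := h Dt.
have [v [mv vz]] := velocity_vmeasurable hT bc zac dz.
have [k [mk k1 ik Flip Fbnd]] := exists_rate hT hlip hbnd zac.
have [rho [rho0 rhor rhod]] := decreasing_minorant hrc hr.
have Fcl t x : horizon T t -> closed (F t x) by move=> Dt; have [] := hF t x Dt.
have mF (x : R -> X) : abs_continuous (horizon T) x -> forall O : set X, open O ->
    (((@wlength R idfun)^*)%mu.-cara.-measurable)
      [set t | horizon T t /\ F t (x t) `&` O !=set0].
  move=> xac O oO.
  have mD : (((@wlength R idfun)^*)%mu.-cara.-measurable) (horizon T).
    by apply: measurable_lebesgue_set; exact: measurable_horizon.
  have mx (O' : set X) : open O' ->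
      (((@wlength R idfun)^*)%mu.-cara.-measurable) (horizon T `&` x @^-1` O').
    by move=> oO'; apply: measurable_lebesgue_set; exact: abs_continuous_preimage.
  have := lebesgue_borel_graph mD mx (hmeas O oO).
  rewrite (_ : [set t | _] = [set t | horizon T t /\ F t (x t) `&` O !=set0])//.
  by apply/seteqP; split=> t /= [Dt]; [move=> []|].
have zv : {ae (@lebesgue_measure R), forall t, horizon T t ->
    h^-1 *: (z (h + t) - z t) @[h --> 0^'] --> v t}.
  apply: filterS2 dz vz => t dzt vt Dt; rewrite (vt Dt).
  by apply/derive1P; split=> //; exact: dzt.
have vF : {ae (@lebesgue_measure R), forall t, horizon T t -> clco (F t (z t)) (v t)}.
  by apply: filterS2 zd vz => t h vt Dt; rewrite (vt Dt); have [] := h Dt.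
have rho1 t : horizon T t -> rho t <= 1.
  by move=> Dt; have := rhor t Dt; rewrite le_min => /andP[].
have [x [g [xac xg zx]]] :=
  relaxation_Borel hT bc Fcl mF zac zv mv mk k1 ik Flip Fbnd vF rho0 rho1 rhod.
have zxr t : horizon T t -> `|z t - x t| <= r t.
  move=> Dt; apply: (le_trans (zx t Dt)); have := rhor t Dt.
  by rewrite le_min => /andP[].
(* The initial value is read off the constructed arc; the estimate at t = 0 puts it in the ball. *)
exists (x 0); split.
  by rewrite /closed_ball_/= -hz0; apply: zxr; exact: horizon0.
exists x; split=> //; split=> //.
apply: filterS xg => t h Dt; have [/derive1P[dx <-] Fg] := h Dt.
by split.
Qed.
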